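(* Consider the Gauss linear model: $\mathbf{x}_n\in\mathbb{R}^K$, $n=1,2,\ldots$, are deterministic vectors and $y_n=\alpha+\boldsymbol{\beta}\cdot\mathbf{x}_n+\xi_n$, where $\alpha\in\mathbb{R}$ and $\boldsymbol{\beta}\in\mathbb{R}^K$ are unknown and $\xi_1,\xi_2,\ldots$ are IID $N(0,\sigma^2)$ random variables with unknown variance $\sigma^2>0$. Assume that for every $l\ge 1$ the matrix $\mathbf{Z}_l$ has full rank, i.e. $\operatorname{rank}\mathbf{Z}_l=\min(l,K+1)$. Let $\varepsilon\in(0,1)$, and for $n\ge K+3$ let $$\Gamma_n^\varepsilon:=\left\{y\in\mathbb{R}: |y-\hat y_n|<t_{n-K-2}^{\varepsilon/2}\sqrt{1+\mathbf{z}_n'(\mathbf{Z}_{n-1}'\mathbf{Z}_{n-1})^{-1}\mathbf{z}_n}\,\hat\sigma_{n-1}\right\}$$ be the classical prediction interval. Then the events $y_n\notin\Gamma_n^\varepsilon$, $n=K+3,K+4,\ldots$, are independent. In particular, the confidence predictor $(\Gamma_n^\varepsilon)$ is strongly valid for $n\ge K+3$.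
   Context: Let $\mathbf{z}_n:=(1,\mathbf{x}_n')'\in\mathbb{R}^{K+1}$. For $l=1,2,\ldots$, $\mathbf{Z}_l$ is the $l\times(K+1)$ matrix whose rows are $\mathbf{z}_i'$, $i=1,\ldots,l$, and $\mathbf{y}_l$ is the vector $(y_1,\ldots,y_l)'$; prime denotes transpose. For $l\ge K+1$, $\hat{\boldsymbol\gamma}_l:=(\mathbf{Z}_l'\mathbf{Z}_l)^{-1}\mathbf{Z}_l'\mathbf{y}_l$ is the least-squares estimate. The least-squares prediction for $y_n$ is $\hat y_n:=\hat{\boldsymbol\gamma}_{n-1}\cdot\mathbf{z}_n$. For $l\geq K+2$, $\hat\sigma_l\ge0$ is defined by $\hat\sigma_l^2:=\frac{1}{l-K-1}(\mathbf{y}_l-\mathbf{Z}_l\hat{\boldsymbol\gamma}_l)'(\mathbf{y}_l-\mathbf{Z}_l\hat{\boldsymbol\gamma}_l)$. $t_m^\delta$ is the upper $\delta$ point of the $t$-distribution with $m$ degrees of freedom (i.e. a $t$-distributed variable with $m$ degrees of freedom exceeds $t_m^\delta$ with probability $\delta$). For $n<K+3$, $\Gamma_n^\varepsilon:=\mathbb{R}$. Let $\mathrm{err}_n^\varepsilon:=1$ if $y_n\notin\Gamma_n^\varepsilon$ and $0$ otherwise. The confidence predictor is strongly valid for $n\ge K+3$ if, under any probability distribution in the model (i.e. for any $\alpha,\boldsymbol\beta,\sigma^2$): for every $n\ge K+3$ and $\varepsilon\in(0,1)$ the probability that $\mathrm{err}_n^\varepsilon=1$ is $\varepsilon$; and,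 for each fixed $\varepsilon\in(0,1)$, the random variables $\mathrm{err}_n^\varepsilon$, $n\ge K+3$, are independent. *)

(* Defs.v *)
From HB Require Import structures.
From mathcomp Require Import all_boot all_order all_algebra.
From mathcomp Require Import finmap.
From mathcomp Require Import all_classical all_reals all_analysis.
From mathcomp Require Import measurable_realfun.

Set Implicit Arguments.
Unset Strict Implicit.
Unset Printing Implicit Defensive.

Import Order.TTheory GRing.Theory Num.Theory.
Import numFieldNormedType.Exports.

Local Open Scope classical_set_scope.
Local Open Scope ring_scope.

Definition independent_events (d : measure_display) (T : measurableType d)
    (R : realType) (P : probability T R) (I : choiceType) (D : set I)
    (E : I -> set T) : Prop :=
  (forall i, D i -> measurable (E i)) /\
  (forall J : {fset I}, [set` J] `<=` D ->
     P (\bigcap_(i in [set` J]) E i) = (\prod_(i <- J) P (E i))%E).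

(* As the preimages of all Borel sets have to be measurable, this includes the
   measurability of every X i with i in D. *)
Definition independent_variables (d : measure_display) (T : measurableType d)
    (R : realType) (P : probability T R) (I : choiceType) (D : set I)
    (X : I -> T -> R) : Prop :=
  forall B : I -> set R, (forall i, measurable (B i)) ->
    independent_events P D (fun i => X i @^-1` B i).

Section tdist.
Context {R : realType}.

(* normal_prob is a measure on this copy of R, which carries the same Borel
   sigma-algebra as R but another display. *)
Local Notation mR := (measurableTypeR R).

Definition sqr_add (p : mR * mR) : mR := (p.1 : R) ^+ 2 + (p.2 : R).

Lemma measurable_sqr_add : measurable_fun [set: mR * mR] sqr_add.
Proof.
apply: (@measurable_funD _ (mR * mR)%type R); last exact: measurable_snd.
by apply: measurable_funX; exact: measurable_fst.
Qed.

HB.instance Definition _ :=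
  isMeasurableFun.Build _ _ (mR * mR)%type mR sqr_add measurable_sqr_add.

(* The law of Z_1 ^ 2 + ... + Z_m ^ 2 for independent standard normal Z_i. *)
Fixpoint chi2_prob (m : nat) : probability mR R :=
  if m is m'.+1 then
    distribution (normal_prob 0 1 \x chi2_prob m')%E sqr_add
  else \d_((0 : R) : mR).

Definition t_ratio (m : nat) (p : mR * mR) : mR :=
  (p.1 : R) / Num.sqrt ((p.2 : R) / m%:R).

Lemma measurable_inv : measurable_fun [set: R] (@GRing.inv R).
Proof.
have onz : open [set r : R | r != 0] by exact: open_neq.
rewrite (_ : [set: R] = [set r | r != 0] `|` [set 0]); last first.
  by apply/seteqP; split => // r _ /=; have [->|] := eqVneq r 0; [right|left].
apply/measurable_funU; [exact: open_measurable|exact: measurable_set1|].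
split; last exact: measurable_fun_set1.
apply: open_continuous_measurable_fun => //.
by apply/in_setP => r /= r0; exact: inv_continuous.
Qed.

Lemma measurable_t_ratio m : measurable_fun [set: mR * mR] (t_ratio m).
Proof.
apply: (@measurable_funM _ (mR * mR)%type R); first exact: measurable_fst.
apply: (measurableT_comp measurable_inv).
apply: (@measurableT_comp _ _ _ _ R _ (@Num.sqrt R)).
  by apply: continuous_measurable_fun; exact: sqrt_continuous.
apply: measurable_funM; [exact: measurable_snd | exact: measurable_cst].
Qed.

HB.instance Definition _ m :=
  isMeasurableFun.Build _ _ (mR * mR)%type mR (t_ratio m)
    (measurable_t_ratio m).

(* Student's t-distribution with m degrees of freedom: the law of
   Z / sqrt (V / m) for independent Z, V with Z standard normal and V
   chi-squared with m degrees of freedom. *)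
Definition t_prob (m : nat) : probability mR R :=
  distribution (normal_prob 0 1 \x chi2_prob m)%E (t_ratio m).

(* The set is a singleton for 0 < m and 0 < delta < 1. *)
Definition t_upper (m : nat) (delta : R) : R :=
  xget 0 [set t : R | t_prob m `]t, +oo[%classic = delta%:E].

End tdist.

(* Time is numbered from 1; the index 0 of x, y and xi is a dummy. The natural
   number subtractions below are only used for l >= K + 2 and n >= K + 3, where
   they are not truncated. *)
Section linear_model.
Context {R : realType} {K : nat}.
Variable x : nat -> 'cV[R]_K.

Definition zvec (n : nat) : 'cV[R]_(1 + K) := col_mx (const_mx 1) (x n).

Definition Zmx (l : nat) : 'M[R]_(l, 1 + K) := \matrix_(i < l) (zvec i.+1)^T.

Definition labels (y : nat -> R) (l : nat) : 'cV[R]_l := \col_(i < l) y i.+1.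

Definition gammahat (l : nat) (yl : 'cV[R]_l) : 'cV[R]_(1 + K) :=
  invmx ((Zmx l)^T *m Zmx l) *m (Zmx l)^T *m yl.

Definition yhat (n : nat) (yl : 'cV[R]_n.-1) : R :=
  ((gammahat yl)^T *m zvec n) 0 0.

Definition sigmahat (l : nat) (yl : 'cV[R]_l) : R :=
  let r := yl - Zmx l *m gammahat yl in
  Num.sqrt ((l - K - 1)%:R^-1 * (r^T *m r) 0 0).

(* For every significance level and every n, a set of labels that depends on
   y_1, ..., y_{n-1} only (the vectors x being fixed). *)
Definition confidence_predictor : Type :=
  R -> forall n : nat, 'cV[R]_n.-1 -> set R.

Definition classical_predictor : confidence_predictor :=
  fun eps n yl =>
    if (n < K + 3)%N then setT else
    [set y : R | `|y - yhat yl| <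
       t_upper (n - K - 2) (eps / 2)
       * Num.sqrt (1 + ((zvec n)^T *m invmx ((Zmx n.-1)^T *m Zmx n.-1)
                          *m zvec n) 0 0)
       * sigmahat yl].

Definition response (T : Type) (alpha : R) (beta : 'cV[R]_K)
    (xi : nat -> T -> R) (n : nat) (w : T) : R :=
  alpha + (beta^T *m x n) 0 0 + xi n w.

(* sigma is the standard deviation, the second parameter of normal_prob. *)
Definition gauss_noise (d : measure_display) (T : measurableType d)
    (P : probability T R) (sigma : R) (xi : nat -> {RV P >-> R}) : Prop :=
  (forall n, (0 < n)%N -> forall A : set R, measurable A ->
     distribution P (xi n) A = normal_prob 0 sigma A) /\
  independent_variables P [set n | (0 < n)%N] xi.

Arguments gauss_noise {d T} P sigma xi.

Definition miss (Gamma : confidence_predictor) (eps : R) (y : nat -> R)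
    (n : nat) : Prop :=
  ~ Gamma eps n (labels y n.-1) (y n).

Definition err (Gamma : confidence_predictor) (eps : R) (y : nat -> R)
    (n : nat) : R :=
  if `[< miss Gamma eps y n >] then 1 else 0.

Definition strongly_valid (N : nat) (Gamma : confidence_predictor) : Prop :=
  forall (d : measure_display) (T : measurableType d) (P : probability T R)
    (alpha : R) (beta : 'cV[R]_K) (sigma : R) (xi : nat -> {RV P >-> R}),
    0 < sigma -> gauss_noise P sigma xi ->
    let y w n := response alpha beta xi n w in
    (forall n eps, (N <= n)%N -> 0 < eps < 1 ->
       P [set w | err Gamma eps (y w) n = 1] = eps%:E) /\
    (forall eps, 0 < eps < 1 ->
       independent_variables P [set n | (N <= n)%N]
         (fun n w => err Gamma eps (y w) n)).

End linear_model.

Arguments gauss_noise {R d T} P sigma xi.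

(* Main.v *)
Require Import Defs.
From HB Require Import structures.
From mathcomp Require Import all_boot all_order all_algebra.
From mathcomp Require Import finmap ring lra zify.
From mathcomp Require Import all_classical all_reals all_analysis.
From mathcomp Require Import measurable_realfun.
Set Implicit Arguments.
Unset Strict Implicit.
Unset Printing Implicit Defensive.
Import Order.TTheory GRing.Theory Num.Theory.
Import numFieldNormedType.Exports.
Local Open Scope classical_set_scope.
Local Open Scope ring_scope.

(** Number the standardized one-step prediction errors ([recres])
    [w_l = (y_(l+1) - yhat_(l+1)) / sqrt (1 + h_l)], [l >= K + 1], where [h_l]
    is the leverage of the new observation, and put [W_j = w_(K+1+j) / sigma].

    Least squares gives two algebraic facts. First, [w_l] is a combination of
    the noise alone, and the coefficient vectors of the [w_l] are orthonormal
    ([recres_coef_design], [recres_coef_orthonormal]). Orthonormal combinations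
    of independent standard normal variables are again such
    ([std_iid_orthonormal]), so the [W_j] are independent and standard normal.
    Secondly, the residual sum of squares of the first [K + 1 + j] observations
    is the sum of the [w_(K+1+i) ^ 2] with [i < j] ([rss_recres]). With
    [S_j = W_0 ^ 2 + ... + W_(j-1) ^ 2], missing the observation number
    [K + 2 + j] therefore means [t * sqrt (S_j / j) <= |W_j|] ([missE]), a
    condition on the pair [(W_j, S_j)] which does not change when the pair
    becomes [(a W_j, a ^ 2 S_j)], [a > 0]: the pair lies in a cone.

    Such a condition is independent of [S_(j+1) = W_j ^ 2 + S_j]
    ([normal_chi2_cone]). Inductively, the conditions with index less than [j]
    are jointly independent of [S_j], of [W_j] and of all that follows, hence of
    the [j]-th condition ([cone_chain]). As any cone may be used, this covers the
    events [err = 0], [err = 1] and all preimages under [err].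

    Two facts about the normal law carry the probabilistic part.
    - It is invariant under rotations of the plane ([std_normal2_rotation]),
      because a rotation is a product of three shears, which preserve Lebesgue
      measure by Fubini's theorem. A matrix with orthonormal rows is brought to
      the standard form by rotations in coordinate planes
      ([givens_clear_row]), which gives [std_iid_orthonormal].
    - Multiplied by [exp (s / 2)], [s] being the squared radius, the law of
      [(W_j, S_j)] becomes homogeneous under the dilations above. Its part in a
      cone then gives the ball of squared radius [r] a mass proportional to a
      power of [r] that does not depend on the cone; so the distribution of [s]
      in a cone is, up to a factor, the same for all cones
      ([polar_independence]).

    Finally each miss has probability [eps], as Student's law is symmetric and
    has no atoms ([normal_chi2_t_event]). *)

(** * Integration against a density *)

Section density.
Local Open Scope ereal_scope.
Context d (T : measurableType d) (R : realType).
Variables (mu nu : {measure set T -> \bar R}) (f : T -> R).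
Hypotheses (mf : measurable_fun setT f) (f0 : forall x, (0 <= f x)%R).
Hypothesis nuE : forall A, measurable A -> nu A = \int[mu]_(x in A) (f x)%:E.

Import HBNNSimple.

(** Both sides are additive and continuous along increasing sequences, so
    simple functions suffice. *)
Lemma integral_density g : measurable_fun setT g -> (forall x, 0 <= g x) ->
  \int[nu]_x g x = \int[mu]_x (g x * (f x)%:E).
Proof.
move=> mg g0.
pose g_ := nnsfun_approx measurableT mg.
have cvg_g x : (EFin \o (fun n => g_ n x)) n @[n --> \oo] --> g x.
  by apply: cvg_nnsfun_approx.
have gE x : g x = limn (fun n => (g_ n x)%:E) by apply/esym/cvg_lim => //; exact: cvg_g.
transitivity (limn (fun n => \int[nu]_x (g_ n x)%:E)).
  rewrite -monotone_convergence//; last 3 first.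
  - by move=> n; exact/measurable_EFinP.
  - by move=> n x _; rewrite lee_fin.
  - by move=> x _ m n mn; rewrite lee_fin; exact/lefP/nd_nnsfun_approx.
  by apply: eq_integral => x _; rewrite gE.
transitivity (limn (fun n => \int[mu]_x ((g_ n x)%:E * (f x)%:E))); last first.
  rewrite -monotone_convergence//; last 3 first.
  - by move=> n; apply: emeasurable_funM; exact/measurable_EFinP.
  - by move=> n x _; rewrite mule_ge0 ?lee_fin.
  - move=> x _ m n mn; rewrite lee_wpmul2r ?lee_fin//.
    exact/lefP/nd_nnsfun_approx.
  apply: eq_integral => x _; apply/cvg_lim => //.
  by apply: cvgeZr => //; exact: cvg_g.
apply: congr_lim; apply/funext => n.
under eq_integral do rewrite fimfunE -fsumEFin//.
rewrite ge0_integral_fsum//; last 2 first.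
- by move=> r; exact/measurable_EFinP/measurable_funM.
- by move=> r x _; rewrite nnfun_muleindic_ge0.
transitivity (\int[mu]_x
   (\sum_(k \in range (g_ n)) (k * \1_(g_ n @^-1` [set k]) x)%:E * (f x)%:E)).
  rewrite ge0_integral_fsum//; last 2 first.
  - move=> r; apply: emeasurable_funM; last exact/measurable_EFinP.
    exact/measurable_EFinP/measurable_funM.
  - move=> r x _; apply: mule_ge0; last by rewrite lee_fin.
    by rewrite EFinM nnfun_muleindic_ge0.
  apply: eq_fsbigr => r _; rewrite integralZl_indic_nnsfun// integral_indic//.
  have mr : measurable (g_ n @^-1` [set r]) by exact: measurable_funPTI.
  rewrite setIT nuE//.
  have [r0|r0] := leP 0%R r; last first.
    rewrite preimage_nnfun0// integral_set0 mule0 integral0_eq// => x _.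
    by rewrite indicE in_set0 mulr0 mul0e.
  rewrite -ge0_integralZl//; last 2 first.
  - by apply: measurable_funTS; exact/measurable_EFinP.
  - by move=> x _; rewrite lee_fin.
  rewrite integral_mkcond; apply: eq_integral => x _.
  rewrite patchE indicE; case: ifPn => _; first by rewrite mulr1.
  by rewrite mulr0 mul0e.
apply: eq_integral => x _.
rewrite [in RHS]fimfunE -fsumEFin// ge0_mule_fsuml//.
by move=> r; rewrite EFinM nnfun_muleindic_ge0.
Qed.

End density.

(** * Affine images of Lebesgue measure *)

Section image_measure.
Context d d' (T1 : measurableType d) (T2 : measurableType d') (R : realType).
Variables (m : {measure set T1 -> \bar R}) (f : T1 -> T2).
Hypothesis mf : measurable_fun [set: T1] f.

(** The measure structure of a push-forward depends on a proof that the map is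
    measurable; this definition takes that proof as an argument. *)
Definition image_measure : {measure set T2 -> \bar R} :=
  measure_function_pushforward__canonical__measure_function_Measure m mf.

End image_measure.

Section affine.
Local Open Scope ereal_scope.
Context {R : realType}.
Notation mR := (measurableTypeR R).
Notation lam := (@lebesgue_measure R).

Lemma ocitv_le (X : set mR) : ocitv X ->
  exists x y : R, (x <= y)%R /\ X = `]x, y]%classic.
Proof.
move=> [[x y] _ <-]; have [xy|yx] := leP x y; first by exists x, y.
exists x, x; rewrite lexx; split => //.
by rewrite !set_itv_ge// -leNgt// bnd_simp ?ltW.
Qed.

(** Lebesgue measure is determined by its values on half-open intervals. *)
Lemma lebesgue_affine (a b : R) (A : set R) : a != 0%R -> measurable A ->
  (`|a|)%:E * lam [set z | A (a * z + b)%R] = lam A.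
Proof.
move=> a0 mA; apply/esym.
pose f : mR -> mR := fun z => (a * z + b)%R.
have mf : measurable_fun [set: mR] f.
  by apply: (@measurable_funD _ mR R) => //; exact: measurable_funM.
pose m : {measure set mR -> \bar R} :=
  mscale (NngNum (normr_ge0 a)) (image_measure lam mf).
transitivity (m A) => //.
apply: lebesgue_measure_unique => // X /ocitv_le[x [y [xy ->]]].
change (lam `]x, y]%classic = (`|a|)%:E * lam (f @^-1` `]x, y]%classic)).
have [{}a0|a_le0] := ltP 0%R a.
  rewrite (_ : _ @^-1` _ = `]((x - b) / a)%R, ((y - b) / a)%R]%classic); last first.
    apply/seteqP; split => z /=; rewrite !in_itv/= /f;
    by rewrite ltr_pdivrMr// ler_pdivlMr// ltrBlDr lerBrDr (mulrC z).
  rewrite !lebesgue_measure_itv/= !lte_fin ltr_pM2r ?invr_gt0// ltrD2r.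
  case: ifPn => _; last by rewrite mule0.
  by rewrite -EFinM gtr0_norm//; congr (_%:E); field; rewrite gt_eqF.
have {}a0 : (a < 0)%R by rewrite lt_neqAle a0.
rewrite (_ : _ @^-1` _ = `[((y - b) / a)%R, ((x - b) / a)%R[%classic); last first.
  apply/seteqP; split => z /=; rewrite !in_itv/= /f;
  by rewrite ltr_ndivlMr// ler_ndivrMr// ltrBlDr lerBrDr (mulrC z) andbC.
rewrite !lebesgue_measure_itv/= !lte_fin ltr_nM2r ?invr_lt0// ltrD2r.
case: ifPn => _; last by rewrite mule0.
by rewrite -EFinM ltr0_norm//; congr (_%:E); field; rewrite lt_eqF.
Qed.

Lemma integral_affine (a b : R) (g : R -> \bar R) : a != 0%R ->
  measurable_fun setT g -> (forall x, 0 <= g x) ->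
  (`|a|)%:E * \int[lam]_z g (a * z + b)%R = \int[lam]_z g z.
Proof.
move=> a0 mg g0.
pose f : mR -> mR := fun z => (a * z + b)%R.
have mf : measurable_fun [set: mR] f.
  by apply: (@measurable_funD _ mR R) => //; exact: measurable_funM.
pose m : {measure set mR -> \bar R} :=
  mscale (NngNum (normr_ge0 a)) (image_measure lam mf).
transitivity (\int[m]_z g z).
  rewrite ge0_integral_mscale//; congr (_ * _).
  by rewrite /image_measure ge0_integral_pushforward.
by apply: eq_measure_integral => A mA _; exact: lebesgue_affine.
Qed.

End affine.

(** * The standard normal law and rotations of the plane *)

Section std_normal.
Local Open Scope ereal_scope.
Context {R : realType}.
Notation mR := (measurableTypeR R).
Notation lam := (@lebesgue_measure R).
Notation N := (@normal_prob R 0 1).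

Lemma std_normal_pdfE (x : R) :
  normal_pdf 0 1 x = (normal_peak 1 * expR (- (x ^+ 2 / 2)))%R.
Proof.
by rewrite normal_pdfE ?oner_neq0// /normal_fun subr0 expr1n mulNr.
Qed.

Lemma std_normal_pdf2 (x y u v : R) : (x ^+ 2 + y ^+ 2 = u ^+ 2 + v ^+ 2)%R ->
  (normal_pdf 0 1 x * normal_pdf 0 1 y = normal_pdf 0 1 u * normal_pdf 0 1 v)%R.
Proof.
move=> e; rewrite !std_normal_pdfE mulrACA [RHS]mulrACA -!expRD -!opprD.
by rewrite -!mulrDl e.
Qed.

Lemma integral_normal_prob (s : R) (g : R -> \bar R) :
  measurable_fun setT g -> (forall x, 0 <= g x) ->
  \int[normal_prob 0 s]_z g z = \int[lam]_z (g z * (normal_pdf 0 s z)%:E).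
Proof.
move=> mg g0; apply: integral_density => //.
  exact: measurable_normal_pdf.
by move=> x; exact: normal_pdf_ge0.
Qed.

(** The substitution [z -> s z] in the integral of the density. *)
Lemma normal_prob_scale (s : R) (A : set R) : (0 < s)%R -> measurable A ->
  normal_prob 0 s A = N [set z | A (s * z)%R].
Proof.
move=> s0 mA.
have mA' : measurable [set z | A (s * z)%R].
  have ms : measurable_fun setT (fun z : R => (s * z)%R) by exact: measurable_funM.
  by rewrite -[X in measurable X]setTI; exact: ms.
rewrite /normal_prob integral_mkcond [RHS]integral_mkcond.
rewrite -(@integral_affine _ s 0)//; last 3 first.
- by rewrite gt_eqF.
- apply/measurable_restrict => //; apply: measurable_funTS.
  by apply/measurable_EFinP; exact: measurable_normal_pdf.
- move=> x; rewrite patchE; case: ifP => // _.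
  by rewrite lee_fin normal_pdf_ge0.
rewrite -ge0_integralZl//; last 2 first.
- have ms : measurable_fun setT (fun z : R => (s * z + 0)%R).
    by apply: measurable_funD => //; exact: measurable_funM.
  apply: (@measurableT_comp _ _ _ _ _ _ _ _ _ _ ms).
  apply/measurable_restrict => //; apply: measurable_funTS.
  by apply/measurable_EFinP; exact: measurable_normal_pdf.
- move=> x _; rewrite patchE; case: ifP => // _.
  by rewrite lee_fin normal_pdf_ge0.
apply: eq_integral => z _; rewrite addr0 !patchE.
have -> : ((s * z)%R \in A) = (z \in [set z | A (s * z)%R]).
  by apply/idP/idP; rewrite !inE.
case: ifP => _; last by rewrite mule0.
rewrite -EFinM; congr (_%:E).
rewrite std_normal_pdfE normal_pdfE ?gt_eqF// /normal_fun /normal_peak subr0.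
rewrite gtr0_norm// mulrA; congr (_ * _)%R; last first.
  by congr expR; field; rewrite gt_eqF.
rewrite expr1n mul1r -mulrnAr sqrtrM ?sqr_ge0// sqrtr_sqr gtr0_norm//.
by rewrite invfM mulrA divff ?gt_eqF// mul1r.
Qed.

Lemma std_normalN (A : set R) : measurable A -> N [set z | A (- z)%R] = N A.
Proof.
move=> mA; rewrite /normal_prob integral_mkcond [RHS]integral_mkcond.
rewrite -[RHS](@integral_affine _ (-1)%R 0)//; last 2 first.
- apply/measurable_restrict => //; apply: measurable_funTS.
  by apply/measurable_EFinP; exact: measurable_normal_pdf.
- move=> x; rewrite patchE; case: ifP => // _.
  by rewrite lee_fin normal_pdf_ge0.
rewrite normrN normr1 mul1e; apply: eq_integral => z _.
rewrite addr0 mulN1r !patchE.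
have -> : ((- z)%R \in A) = (z \in [set z | A (- z)%R]).
  by apply/idP/idP; rewrite !inE.
by rewrite !std_normal_pdfE sqrrN.
Qed.

(** The weight cancels the exponential in the density, so that only Lebesgue
    measure and its scaling factor are left. *)
Lemma std_normal_homogeneous (a : R) (g : R -> \bar R) : (0 < a)%R ->
  measurable_fun setT g -> (forall x, 0 <= g x) ->
  \int[N]_z (g (a * z)%R * (expR (z ^+ 2 / 2))%:E) =
  a^-1%:E * \int[N]_z (g z * (expR (z ^+ 2 / 2))%:E).
Proof.
move=> a0 mg g0.
have mexp : measurable_fun setT (fun z : R => (expR (z ^+ 2 / 2))%:E).
  apply/measurable_EFinP/measurableT_comp => //.
  by apply: measurable_funM => //; exact: measurable_funX.
have key h : measurable_fun setT h -> (forall x, 0 <= h x) ->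
    \int[N]_z (h z * (expR (z ^+ 2 / 2))%:E) =
    (normal_peak 1)%:E * \int[lam]_z h z.
  move=> mh h0; rewrite integral_normal_prob//; last 2 first.
  - exact: emeasurable_funM.
  - by move=> x; rewrite mule_ge0// lee_fin expR_ge0.
  rewrite -ge0_integralZl//; last by rewrite lee_fin normal_peak_ge0.
  apply: eq_integral => z _; rewrite std_normal_pdfE -muleA -EFinM muleC.
  by rewrite mulrCA -expRD addrN expR0 mulr1.
have ma : measurable_fun setT (fun z : R => (a * z)%R) by exact: measurable_funM.
rewrite (key (fun z => g (a * z)%R))//; last first.
  exact: (@measurableT_comp _ _ _ _ _ _ _ _ _ mg ma).
rewrite key// muleCA; congr (_ * _).
rewrite -(@integral_affine _ a 0 g)// ?gt_eqF// muleA -EFinM gtr0_norm//.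
rewrite mulVf ?gt_eqF// mul1e.
by under [in RHS]eq_integral do rewrite addr0.
Qed.

Definition rotation (c s : R) (p : mR * mR) : mR * mR :=
  ((c * p.1 - s * p.2)%R, (s * p.1 + c * p.2)%R).

(** A shear translates the line on which the other coordinate is fixed. *)
Lemma integral_shear (t : R) (F : mR * mR -> \bar R) :
  measurable_fun setT F -> (forall p, 0 <= F p) ->
  (\int[lam \x lam]_p F ((p.1 + t * p.2)%R : mR, p.2) = \int[lam \x lam]_p F p) /\
  (\int[lam \x lam]_p F (p.1, (p.2 + t * p.1)%R : mR) = \int[lam \x lam]_p F p).
Proof.
move=> mF F0.
have sh y : forall g, measurable_fun setT g -> (forall x, 0 <= g x) ->
    \int[lam]_z g (z + y)%R = \int[lam]_z g z.
  move=> g mg g0; rewrite -[RHS](@integral_affine _ 1%R y)// ?oner_neq0//.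
  by rewrite normr1 mul1e; under [in RHS]eq_integral do rewrite mul1r.
split.
  rewrite fubini_tonelli2//; last first.
    apply: (measurableT_comp mF); apply/measurable_fun_pair => //.
    apply: (@measurable_funD _ (mR * mR)%type R) => //.
    exact: (@measurable_funM _ (mR * mR)%type R).
  rewrite [RHS](fubini_tonelli2 _ mF F0); apply: eq_integral => y _; rewrite /fubini_G/=.
  by rewrite (sh _ (fun z => F (z, y)))//; exact: measurable_fun_pair1.
rewrite fubini_tonelli1//; last first.
  apply: (measurableT_comp mF); apply/measurable_fun_pair => //.
  apply: (@measurable_funD _ (mR * mR)%type R) => //.
  exact: (@measurable_funM _ (mR * mR)%type R).
rewrite [RHS](fubini_tonelli1 _ mF F0); apply: eq_integral => x _; rewrite /fubini_F/=.
by rewrite (sh _ (fun z => F (x, z)))//; exact: measurable_fun_pair2.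
Qed.

Lemma measurable_rotation c s : measurable_fun setT (rotation c s).
Proof.
by apply/measurable_fun_pair;
  [apply: (@measurable_funB _ (mR * mR)%type R)|
   apply: (@measurable_funD _ (mR * mR)%type R)];
  exact: (@measurable_funM _ (mR * mR)%type R).
Qed.

(** A rotation by an angle [u] with [sin u = s <> 0] is the product of three
    shears, of slopes [t], [s] and [t], where [t = - tan (u / 2)]. *)
Lemma integral_rotation (c s : R) (F : mR * mR -> \bar R) : s != 0%R ->
  (c ^+ 2 + s ^+ 2 = 1)%R ->
  measurable_fun setT F -> (forall p, 0 <= F p) ->
  \int[lam \x lam]_p F (rotation c s p) = \int[lam \x lam]_p F p.
Proof.
move=> s0 cs mF F0; pose t := ((c - 1) / s)%R.
pose h1 := fun p : mR * mR => ((p.1 + t * p.2)%R : mR, p.2).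
pose h2 := fun p : mR * mR => (p.1, (p.2 + s * p.1)%R : mR).
have m1 : measurable_fun setT h1.
  apply/measurable_fun_pair => //.
  apply: (@measurable_funD _ (mR * mR)%type R) => //.
  exact: (@measurable_funM _ (mR * mR)%type R).
have m2 : measurable_fun setT h2.
  apply/measurable_fun_pair => //.
  apply: (@measurable_funD _ (mR * mR)%type R) => //.
  exact: (@measurable_funM _ (mR * mR)%type R).
have rotE p : rotation c s p = h1 (h2 (h1 p)).
  case: p => x y; rewrite /rotation /h1 /h2 /t /=.
  have c2 : (c ^+ 2 = 1 - s ^+ 2)%R by rewrite -cs addrK.
  congr (_, _); last by field.
  apply/eqP; rewrite -subr_eq0; apply/eqP.
  (* The two sides differ by a multiple of 1 - s ^ 2 - c ^ 2. *)
  transitivity ((1 - s ^+ 2 - c ^+ 2) / s * y)%R; last by rewrite c2 subrr !mul0r.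
  by field.
under eq_integral do rewrite rotE.
have e1 G : measurable_fun setT G -> (forall p, 0 <= G p) ->
    \int[lam \x lam]_p G (h1 p) = \int[lam \x lam]_p G p.
  by move=> mG G0; exact: (integral_shear t mG G0).1.
rewrite (e1 (fun p => F (h1 (h2 p))))//; last first.
  by apply: (measurableT_comp mF); exact: (measurableT_comp m1).
have mF1 : measurable_fun setT (fun p => F (h1 p)) by exact: (measurableT_comp mF).
have /= -> := (integral_shear s mF1 (fun p => F0 _)).2.
exact: e1.
Qed.

Lemma integral_std_normal2 (F : mR * mR -> \bar R) :
  measurable_fun setT F -> (forall p, 0 <= F p) ->
  \int[N \x N]_p F p =
  \int[lam \x lam]_p (F p * (normal_pdf 0 1 p.1 * normal_pdf 0 1 p.2)%:E).
Proof.
move=> mF F0.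
have mpdf : measurable_fun setT (fun z : R => (normal_pdf 0 1 z)%:E).
  by apply/measurable_EFinP; exact: measurable_normal_pdf.
have mpdf2 : measurable_fun [set: mR * mR]
    (fun p => (normal_pdf 0 1 p.1 * normal_pdf 0 1 p.2)%:E).
  apply/measurable_EFinP; apply: (@measurable_funM _ (mR * mR)%type R);
  exact: (measurableT_comp (measurable_normal_pdf 0 1)).
rewrite fubini_tonelli1// fubini_tonelli1//; last 2 first.
- exact: emeasurable_funM.
- by move=> p; rewrite mule_ge0// lee_fin mulr_ge0// normal_pdf_ge0.
rewrite integral_normal_prob//; last 2 first.
- exact: measurable_fun_fubini_tonelli_F.
- by move=> x; exact: integral_ge0.
apply: eq_integral => x _; rewrite /fubini_F/= integral_normal_prob//; last first.
  exact: measurable_fun_pair2.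
rewrite -ge0_integralZr//; last 3 first.
- by apply: emeasurable_funM => //; exact: measurable_fun_pair2.
- by move=> y _; rewrite mule_ge0// lee_fin normal_pdf_ge0.
- by rewrite lee_fin normal_pdf_ge0.
by apply: eq_integral => y _; rewrite -muleA -EFinM mulrC.
Qed.

(** The joint density depends on the radius only. *)
Lemma std_normal2_rotation (c s : R) (C : set (mR * mR)) : s != 0%R ->
  (c ^+ 2 + s ^+ 2 = 1)%R -> measurable C ->
  (N \x N) (rotation c s @^-1` C) = (N \x N) C.
Proof.
move=> s0 cs mC.
have mrC : measurable (rotation c s @^-1` C).
  by rewrite -[X in measurable X]setTI; exact: measurable_rotation.
have mpdf2 : measurable_fun [set: mR * mR]
    (fun p => (normal_pdf 0 1 p.1 * normal_pdf 0 1 p.2)%:E).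
  apply/measurable_EFinP; apply: (@measurable_funM _ (mR * mR)%type R);
  exact: (measurableT_comp (measurable_normal_pdf 0 1)).
have E A : measurable A -> (N \x N) A = \int[lam \x lam]_p
    ((\1_A p)%:E * (normal_pdf 0 1 p.1 * normal_pdf 0 1 p.2)%:E).
  move=> mA; rewrite -[LHS]mule1.
  have m1A : measurable_fun [set: mR * mR] (fun p => (\1_A p)%:E : \bar R).
    by apply/measurable_EFinP; exact: measurable_indic.
  rewrite -(integral_std_normal2 m1A); last by move=> p; rewrite lee_fin.
  by rewrite (integral_indic _ measurableT mA) setIT mule1.
rewrite (E _ mrC) (E _ mC).
pose F := fun p : mR * mR =>
  (\1_C p)%:E * (normal_pdf 0 1 p.1 * normal_pdf 0 1 p.2)%:E.
have mF : measurable_fun setT F.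
  apply: emeasurable_funM => //.
  by apply/measurable_EFinP; exact: measurable_indic.
have F0 p : 0 <= F p by rewrite mule_ge0// lee_fin ?mulr_ge0// normal_pdf_ge0.
rewrite -[RHS](integral_rotation s0 cs mF F0).
apply: eq_integral => p _; congr (_ * _%:E).
apply: std_normal_pdf2; rewrite /rotation/=.
rewrite -[LHS]mul1r -cs; ring.
Qed.

End std_normal.

(** * Independence relative to an event and Givens rotations *)

Section joint_law.
Local Open Scope ereal_scope.
Context d d1 d2 (T : measurableType d) (T1 : measurableType d1)
  (T2 : measurableType d2) (R : realType) (P : probability T R).
Variables (mu1 : probability T1 R) (mu2 : probability T2 R).

(** Under the conditional probability given [G], the variables [X] and [Y] are
    independent with laws [mu1] and [mu2]; a measure on a product space is
    determined by its values on rectangles. The factor [P G] in place of a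
    conditional probability spares the case [P G = 0] later. *)
Lemma joint_law (G : set T) (X : T -> T1) (Y : T -> T2) : measurable G ->
  measurable_fun setT X -> measurable_fun setT Y ->
  (forall A B, measurable A -> measurable B ->
    P (G `&` (X @^-1` A `&` Y @^-1` B)) = P G * (mu1 A * mu2 B)) ->
  forall C, measurable C ->
    P (G `&` [set w | C (X w, Y w)]) = P G * (mu1 \x mu2) C.
Proof.
move=> mG mX mY PXY C mC.
have mXY : measurable_fun setT (fun w => (X w, Y w)) by exact: measurable_fun_pair.
have mC' : measurable [set w | C (X w, Y w)].
  by rewrite -[X in measurable X]setTI; exact: mXY.
have PGfin : P G \is a fin_num by exact: fin_num_measure.
have [PG0|PG0] := eqVneq (P G) 0.
  rewrite PG0 mul0e; apply: (@subset_measure0 _ _ _ P _ G) => //.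
  exact: measurableI.
have g0 : (0 < fine (P G))%R by rewrite fine_gt0// lt0e PG0 measure_ge0 ltey_eq PGfin.
have gi0 : (0 <= (fine (P G))^-1)%R by rewrite invr_ge0 ltW.
pose m' : {measure set (T1 * T2) -> \bar R} :=
  mscale (NngNum gi0) (image_measure (mrestr P mG) mXY).
have m'E D : measurable D ->
    m' D = (fine (P G))^-1%:E * P (G `&` [set w | D (X w, Y w)]).
  by move=> mD; rewrite [G `&` _]setIC.
have -> : (mu1 \x mu2) C = m' C.
  apply: product_measure_unique => // A B mA mB.
  rewrite m'E; last exact: measurableX.
  rewrite (_ : [set w | _] = X @^-1` A `&` Y @^-1` B)// PXY//.
  by rewrite muleA -[X in _ * X * _]fineK// -EFinM mulVf ?gt_eqF// mul1e.
by rewrite m'E// -{1}[P G]fineK// muleA -EFinM divff ?mul1e// gt_eqF.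
Qed.

End joint_law.

Section std_iid.
Local Open Scope ereal_scope.
Context d (T : measurableType d) (R : realType) (P : probability T R).
Notation mR := (measurableTypeR R).
Notation N := (@normal_prob R 0 1).

(** The event [G] is carried along so that inductions on the number of
    variables can absorb the variables already treated into it. *)
Definition std_iid (G : set T) (n : nat) (X : nat -> T -> R) : Prop :=
  (forall i, (i < n)%N -> measurable_fun setT (X i)) /\
  (forall B : nat -> set R, (forall i, measurable (B i)) ->
     P (G `&` \bigcap_(i < n) (X i @^-1` B i)) = P G * \prod_(i < n) N (B i)).

Lemma bigcap_mkord_recl n (F : nat -> set T) :
  \bigcap_(i < n.+1) F i = F 0%N `&` \bigcap_(i < n) F i.+1.
Proof.
apply/seteqP; split => [w H|w [H0 H] [|i]]//=.
  by split=> [|i ni]; apply: H.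
by rewrite ltnS => /H.
Qed.

(** The first variable is split off: conditions on it become part of the
    event. *)
Lemma std_iidS G n X : measurable G ->
  std_iid G n.+1 X <->
  measurable_fun setT (X 0%N) /\
  (forall A, measurable A -> P (G `&` X 0%N @^-1` A) = P G * N A /\
     std_iid (G `&` X 0%N @^-1` A) n (X \o succn)).
Proof.
move=> mG; split.
  move=> [mX iX]; split; first exact: mX.
  move=> A mA.
  have PA : P (G `&` X 0%N @^-1` A) = P G * N A.
    have := iX (fun i => if i is 0%N then A else setT).
    rewrite bigcap_mkord_recl big_ord_recl/= big1; last first.
      by move=> i _; rewrite probability_setT.
    rewrite (_ : \bigcap_(i < n) _ = setT) ?setIT ?mule1; last first.
      by apply/seteqP; split.
    by apply => -[|i].
  split => //; split => [i ni|B mB]; first exact: mX.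
  rewrite PA -muleA -setIA.
  have := iX (fun i => if i is j.+1 then B j else A).
  by rewrite bigcap_mkord_recl big_ord_recl/=; apply => -[|i].
move=> [mX0 iX]; split.
  move=> [//|i] /= ni; have [_ [+ _]] := iX setT measurableT.
  exact.
move=> B mB; have [PB [_ iB]] := iX _ (mB 0%N).
rewrite bigcap_mkord_recl setIA (iB (fun i => B i.+1))// PB -muleA.
by rewrite big_ord_recl.
Qed.

(** The rotation with cosine [c] and sine [s] in the plane of the coordinates
    [0] and [j]. *)
Definition givens (c s : R) (j : nat) (u : nat -> R) (i : nat) : R :=
  (if i == 0%N then c * u 0%N - s * u j
  else if i == j then s * u 0%N + c * u j else u i)%R.

Lemma sum_givens c s j n (u v : nat -> R) : (0 < j < n)%N ->
  (c ^+ 2 + s ^+ 2 = 1)%R ->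
  (\sum_(i < n) givens c s j u i * givens c s j v i = \sum_(i < n) u i * v i)%R.
Proof.
move=> /andP[j0 jn] cs; have n0 := ltn_trans j0 jn.
rewrite (bigD1 (Ordinal n0))//= (bigD1 (Ordinal jn))/=; last first.
  by rewrite -val_eqE/= -lt0n.
rewrite [RHS](bigD1 (Ordinal n0))//= [in RHS](bigD1 (Ordinal jn))/=; last first.
  by rewrite -val_eqE/= -lt0n.
rewrite /givens !eqxx [j == 0%N]gtn_eqF// !addrA; congr (_ + _)%R.
  rewrite -[RHS]mul1r -cs; ring.
apply: eq_bigr => i; rewrite -!val_eqE/= => /andP[i0 ij].
by rewrite (negbTE i0) (negbTE ij).
Qed.

Lemma measurable_givens c s j n (X : nat -> T -> R) : (0 < j < n)%N ->
  (forall i, (i < n)%N -> measurable_fun setT (X i)) ->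
  forall i, (i < n)%N -> measurable_fun setT (fun w => givens c s j (X^~ w) i).
Proof.
move=> /andP[j0 jn] mX i ni; have n0 := ltn_trans j0 jn.
have mc k i' : (i' < n)%N -> measurable_fun setT (fun w => k * X i' w)%R.
  by move=> ?; apply: measurable_funM => //; exact: mX.
rewrite /givens; case: (i == 0%N); first exact: measurable_funB (mc _ _ _) (mc _ _ _).
by case: (i == j); [exact: measurable_funD (mc _ _ _) (mc _ _ _)|exact: mX].
Qed.

(** The conditions on the variables other than [0] and [j] become part of the
    event, which leaves the rotation invariance of the law of a pair. *)
Lemma std_iid_givens c s j G n X : measurable G -> (0 < j < n)%N ->
  s != 0%R -> (c ^+ 2 + s ^+ 2 = 1)%R ->
  std_iid G n X -> std_iid G n (fun i w => givens c s j (X^~ w) i).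
Proof.
move=> mG jn s0 cs [mX iX]; split; first exact: measurable_givens.
move=> B mB; case/andP: (jn) => j0 jltn; have n0 := ltn_trans j0 jltn.
have j0F : (j == 0%N) = false by rewrite gtn_eqF.
pose D := [set k | [&& (k < n)%N, k != 0%N & k != j]].
have capE (F : nat -> set T) :
    \bigcap_(k < n) F k = (\bigcap_(k in D) F k) `&` (F 0%N `&` F j).
  apply/seteqP; split => [w H|w [H [H0 Hj]] k /= kn].
    by split => [k /and3P[kn _ _]|]; [exact: H|split; exact: H].
  have [->//|k0] := eqVneq k 0%N; have [->//|kj] := eqVneq k j.
  by apply: H; rewrite /D/= kn k0.
have prodE (f : nat -> \bar R) : \prod_(k < n) f k =
    (\prod_(k < n | (k != 0%N :> nat) && (k != j :> nat)) f k) * (f 0%N * f j).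
  rewrite (bigD1 (Ordinal n0))//= (bigD1 (Ordinal jltn))/=; last first.
    by rewrite -val_eqE/= -lt0n.
  by rewrite muleCA [in RHS]muleC -muleA muleCA.
pose H := G `&` \bigcap_(k in D) (X k @^-1` B k).
have mXB k : (k < n)%N -> measurable (X k @^-1` B k).
  by move=> kn; rewrite -[X in measurable X]setTI; exact: mX.
have mH : measurable H.
  apply: measurableI => //; apply: bigcap_measurableType => //.
  by move=> k /and3P[kn _ _]; exact: mXB.
pose q := P G * \prod_(k < n | (k != 0%N :> nat) && (k != j :> nat)) N (B k).
(* For fixed conditions on the other variables, arbitrary conditions on the two
   rotated ones are allowed. *)
have PH A1 A2 : measurable A1 -> measurable A2 ->
    P (H `&` (X 0%N @^-1` A1 `&` X j @^-1` A2)) = q * (N A1 * N A2).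
  move=> mA1 mA2.
  pose B' k := if k == 0%N then A1 else if k == j then A2 else B k.
  have := iX B'; rewrite capE (prodE (fun k => N (B' k))) /B' eqxx j0F eqxx muleA.
  rewrite setIA => /(_ _)/=.
  rewrite (eq_bigcapr (G := fun k => X k @^-1` B k)); last first.
    by move=> k /and3P[_ /negbTE -> /negbTE ->].
  rewrite (eq_bigr (fun k : 'I_n => N (B k))); last first.
    by move=> k /andP[/negbTE -> /negbTE ->].
  by apply=> k; case: ifP => // _; case: ifP.
have PHq : P H = q.
  have := PH _ _ measurableT measurableT.
  by rewrite !preimage_setT !setIT !probability_setT !mule1.
have m0j : measurable_fun setT (X 0%N) /\ measurable_fun setT (X j).
  by split; exact: mX.
have PH' A1 A2 : measurable A1 -> measurable A2 ->
    P (H `&` (X 0%N @^-1` A1 `&` X j @^-1` A2)) = P H * (N A1 * N A2).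
  by rewrite PHq; exact: PH.
have mB' k : measurable (B k : set mR) by exact: mB.
have mB2 : measurable (B 0%N `*` B j : set (mR * mR)).
  exact: measurableX (mB' _) (mB' _).
have mrB : measurable (rotation c s @^-1` (B 0%N `*` B j)).
  by rewrite -[X in measurable X]setTI; exact: measurable_rotation.
have := @joint_law _ _ _ _ _ _ _ P (normal_prob 0 1) (normal_prob 0 1) H
  _ _ mH m0j.1 m0j.2 PH' _ mrB.
rewrite (std_normal2_rotation s0 cs mB2) PHq.
rewrite (product_measure1E _ _ (mB' 0%N) (mB' j)).
move=> PHrot; rewrite capE (prodE (fun k => N (B k))) muleA -/q -PHrot.
rewrite setIA; congr (P (_ `&` _)).
  congr (_ `&` _); apply: eq_bigcapr => k /and3P[_ k0 kj].
  by rewrite /givens (negbTE k0) (negbTE kj).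
by rewrite /givens eqxx j0F eqxx.
Qed.

End std_iid.

(** * Orthonormal combinations of standard normal variables *)

Section orthonormal.
Context d (T : measurableType d) (R : realType) (P : probability T R).
Notation mR := (measurableTypeR R).
Notation N := (@normal_prob R 0 1).

Definition orthonormal_rows (n k : nat) (A : nat -> nat -> R) : Prop :=
  forall j j', (j < k)%N -> (j' < k)%N ->
    \sum_(i < n) A j i * A j' i = (j == j')%:R.

(** The same rotations act on the variables and on the columns of the matrix,
    hence do not change the combinations. Each of them clears one more entry of
    the first row. *)
Lemma givens_clear_row n k m G A X : (m <= n)%N -> measurable G ->
  std_iid P G n.+1 X -> orthonormal_rows n.+1 k A ->
  exists A' X', [/\ std_iid P G n.+1 X', orthonormal_rows n.+1 k A',
    forall j w, \sum_(i < n.+1) A' j i * X' i w = \sum_(i < n.+1) A j i * X i w &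
    forall i, (0 < i <= m)%N -> A' 0%N i = 0].
Proof.
move=> + mG iX oA; elim: m => [_|m IH mn].
  by exists A, X; split => // -[].
have [A1 [X1 [iX1 oA1 AX1 A1m]]] := IH (ltnW mn).
have [A1m0|A1m0] := eqVneq (A1 0%N m.+1) 0.
  exists A1, X1; split => // i /andP[i0].
  by rewrite leq_eqVlt => /predU1P[->//|im]; apply: A1m; rewrite i0.
set a := A1 0%N 0%N; set b := A1 0%N m.+1 in A1m0 *.
pose r := Num.sqrt (a ^+ 2 + b ^+ 2).
have ab0 : 0 < a ^+ 2 + b ^+ 2.
  by rewrite ltr_wpDl ?sqr_ge0// lt0r sqr_ge0 sqrf_eq0 A1m0.
have r0 : r != 0 by rewrite gt_eqF// sqrtr_gt0.
have r2 : r ^+ 2 = a ^+ 2 + b ^+ 2 by rewrite sqr_sqrtr// ltW.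
(* The rotation which turns (a, b) into (r, 0). *)
pose c := a / r; pose s := - b / r.
have s0 : s != 0 by rewrite mulf_neq0 ?oppr_eq0 ?invr_eq0.
have cs : c ^+ 2 + s ^+ 2 = 1.
  by rewrite /c /s !expr_div_n sqrrN -mulrDl -r2 divff// expf_neq0.
have jn : (0 < m.+1 < n.+1)%N by [].
exists (fun j => givens c s m.+1 (A1 j)).
exists (fun i w => givens c s m.+1 (X1^~ w) i); split.
- exact: std_iid_givens.
- by move=> j j' jk j'k; rewrite sum_givens// oA1.
- by move=> j w; rewrite (sum_givens (A1 j) (X1^~ w) jn cs) AX1.
- move=> i /andP[i0]; rewrite /givens gtn_eqF//.
  case: eqP => [_ _|/eqP im ilem]; last first.
    by apply: A1m; rewrite i0 -ltnS ltn_neqAle im.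
  by rewrite -/a -/b /s /c; field.
Qed.

(** After rotations the first row is [(e, 0, ..., 0)] with [e ^ 2 = 1], and by
    orthogonality the other rows vanish in the first column. The first
    combination is then [e] times the first variable, and the others form a
    smaller instance in the remaining variables. *)
Lemma std_iid_orthonormal n k G A X : measurable G -> std_iid P G n X ->
  orthonormal_rows n k A -> std_iid P G k (fun j w => \sum_(i < n) A j i * X i w).
Proof.
elim: k n G A X => [|k IH] n G A X mG iX oA.
  split => // B mB; rewrite big_ord0 mule1 (_ : \bigcap_(i < 0) _ = setT) ?setIT//.
  by apply/seteqP; split.
case: n iX oA => [|n] iX oA.
  by have /eqP := oA 0%N 0%N erefl erefl; rewrite big_ord0 eqxx eq_sym oner_eq0.
have [A' [X' [iX' oA' AX' A'0]]] := givens_clear_row (leqnn n) mG iX oA.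
have /funext {}AX' : forall j, (fun w => \sum_(i < n.+1) A j i * X i w) =
    (fun w => \sum_(i < n.+1) A' j i * X' i w).
  by move=> j; apply/funext => w; rewrite AX'.
rewrite AX'; set e := A' 0%N 0%N.
have row0 (v : nat -> R) : \sum_(i < n.+1) A' 0%N i * v i = e * v 0%N.
  rewrite big_ord_recl big1 ?addr0// => i _.
  by rewrite A'0 ?mul0r// lift0/=.
have e2 : e * e = 1 by rewrite -row0 (oA' 0%N 0%N).
have col0 j : (j < k)%N -> A' j.+1 0%N = 0.
  move=> jk; have /eqP := oA' 0%N j.+1 erefl jk; rewrite row0 mulf_eq0.
  by case/orP => /eqP // e0; move: e2; rewrite e0 mul0r => /esym/eqP; rewrite oner_eq0.
have rowS j (v : nat -> R) : (j < k)%N ->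
    \sum_(i < n.+1) A' j.+1 i * v i = \sum_(i < n) A' j.+1 i.+1 * v i.+1.
  by move=> jk; rewrite big_ord_recl col0// mul0r add0r.
have /(std_iidS _ _ _ mG)[mX0 iX0] := iX'.
apply/(std_iidS _ _ _ mG); split.
  rewrite (_ : (fun w => _) = fun w => e * X' 0%N w).
    exact: measurable_funM.
  by apply/funext => w; rewrite (row0 (X'^~ w)).
move=> B mB.
have mE : measurable ((fun z => e * z) @^-1` B).
  rewrite -[X in measurable X]setTI.
  by apply: (mulrl_measurable e).
have preE : (fun w => \sum_(i < n.+1) A' 0%N i * X' i w) @^-1` B =
    X' 0%N @^-1` ((fun z => e * z) @^-1` B).
  by apply/funext => w /=; rewrite (row0 (X'^~ w)).
have [PE iE] := iX0 _ mE.
split.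
  rewrite preE PE; congr (_ * _)%E.
  have /eqP : e ^+ 2 = 1 by rewrite expr2.
  rewrite sqrf_eq1 => /orP[] /eqP ->.
    by congr (N _); apply/funext => z /=; rewrite mul1r.
  rewrite -[RHS](std_normalN mB); congr (N _).
  by apply/funext => z /=; rewrite mulN1r.
rewrite preE.
have mGE : measurable (G `&` X' 0%N @^-1` ((fun z => e * z) @^-1` B)).
  apply: measurableI => //; rewrite -[X in measurable X]setTI.
  exact: mX0.
have := IH n _ (fun j i => A' j.+1 i.+1) _ mGE iE.
have oS : orthonormal_rows n k (fun j i => A' j.+1 i.+1).
  by move=> j j' jk j'k; rewrite -(rowS j (A' j'.+1))// oA'.
have YS j : (j < k)%N -> (fun w => \sum_(i < n.+1) A' j.+1 i * X' i w) =
    (fun w => \sum_(i < n) A' j.+1 i.+1 * (X' \o succn) i w).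
  by move=> jk; apply/funext => w; rewrite (rowS j (X'^~ w)).
move=> /(_ oS)[mS iS]; split => [j jk|C mC]; first by rewrite /= YS//; exact: mS.
rewrite -iS//; congr (P (_ `&` _)); apply: eq_bigcapr => j jk.
by rewrite /= YS.
Qed.

End orthonormal.

(** * Independence of direction and radius *)

Section density_measure.
Local Open Scope ereal_scope.
Context d (T : measurableType d) (R : realType).
Variables (mu : {measure set T -> \bar R}) (f : T -> R).
Hypotheses (mf : measurable_fun setT f) (f0 : forall x, (0 <= f x)%R).

(** The proofs are arguments of the definition because the measure structure
    declared below depends on them. *)
Definition density_measure (mf : measurable_fun setT f)
    (f0 : forall x, (0 <= f x)%R) (A : set T) : \bar R :=
  \int[mu]_(x in A) (f x)%:E.

Let density0 : density_measure mf f0 set0 = 0.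
Proof. by rewrite /density_measure integral_set0. Qed.

Let density_ge0 A : 0 <= density_measure mf f0 A.
Proof. by apply: integral_ge0 => x _; rewrite lee_fin. Qed.

Let density_sigma_additive : semi_sigma_additive (density_measure mf f0).
Proof.
move=> F mF tF mUF; rewrite /density_measure ge0_integral_bigcup//; last 2 first.
- by apply: measurable_funTS; exact/measurable_EFinP.
- by move=> x _; rewrite lee_fin.
apply: is_cvg_ereal_nneg_natsum_cond => n _ _.
exact: density_ge0.
Qed.

HB.instance Definition _ := isMeasure.Build _ _ _ (density_measure mf f0)
  density0 density_ge0 density_sigma_additive.

End density_measure.

Section ray_unique.
Local Open Scope ereal_scope.
Context {R : realType}.
Notation mR := (measurableTypeR R).

Lemma measure_ray_unique (m1 m2 : {measure set mR -> \bar R}) :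
  (forall r : R, m1 `]-oo, r[%classic < +oo) ->
  (forall r : R, m1 `]-oo, r[%classic = m2 `]-oo, r[%classic) ->
  forall A, measurable A -> m1 A = m2 A.
Proof.
move=> m1oo m12; have H := @measure_unique _ R mR (@RGenInftyO.G R) (fun n => `]-oo, n%:R[%classic).
apply: H => //.
- exact: RGenInftyO.measurableE.
- move=> _ _ [x ->] [y ->]; exists (Num.min x y).
  by apply/seteqP; split => z /=; rewrite !in_itv/= lt_min => /andP.
- by move=> i; exists i%:R.
- apply/seteqP; split => // x _; exists (Num.truncn `|x|).+1 => //=.
  rewrite in_itv/= (le_lt_trans (ler_norm _))//.
  by rewrite truncnS_gt.
- by move=> _ [x ->].
Qed.

End ray_unique.

(** An abstract space with dilations [delta a] and a squared radius [S]. Under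
    [homogeneous], the measure with density [exp (S / 2)] with respect to [mu]
    is multiplied by a power of [a] when dilated; this measure is the analogue
    of Lebesgue measure when [mu] is a normal law. *)
Section polar.
Local Open Scope ereal_scope.
Context d (T : measurableType d) (R : realType) (mu : probability T R).
Variables (S : T -> R) (delta : R -> T -> T) (q : nat).
Hypothesis mS : measurable_fun setT S.
Hypothesis S_delta : forall a x, (0 < a)%R -> S (delta a x) = (a ^+ 2 * S x)%R.
Hypothesis homogeneous : forall a (F : T -> \bar R), (0 < a)%R ->
  measurable_fun setT F -> (forall x, 0 <= F x) ->
  \int[mu]_x (F (delta a x) * (expR (S x / 2))%:E) =
  (a^-1 ^+ q.+1)%:E * \int[mu]_x (F x * (expR (S x / 2))%:E).

Notation mR := (measurableTypeR R).

Definition expR_half (s : mR) : R := expR (s / 2).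

Lemma measurable_expR_half : measurable_fun setT expR_half.
Proof. by apply: measurableT_comp => //; exact: measurable_funM. Qed.

Lemma expR_half_ge0 s : (0 <= expR_half s)%R.
Proof. exact: expR_ge0. Qed.

Let mS' : measurable_fun [set: T] (S : T -> mR) := mS.

(** The image under [S] of the part in [C] of the measure with density
    [exp (S / 2)]. *)
Definition radial (C : set T) (mC : measurable C) : {measure set mR -> \bar R} :=
  density_measure (image_measure (mrestr mu mC) mS')
    measurable_expR_half expR_half_ge0.

Lemma radialE C (mC : measurable C) B : measurable B ->
  radial mC B = \int[mu]_x ((\1_(C `&` S @^-1` B) x)%:E * (expR (S x / 2))%:E).
Proof.
move=> mB; rewrite /radial/= /density_measure.
have mE : measurable_fun setT (EFin \o expR_half).
  by apply/measurable_EFinP; exact: measurable_expR_half.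
rewrite ge0_integral_pushforward//; last 2 first.
- exact: measurable_funTS.
- by move=> x _; rewrite lee_fin expR_half_ge0.
have mSB : measurable (S @^-1` B) by rewrite -[X in measurable X]setTI; exact: mS.
rewrite integral_mkcond (integral_density (f := \1_C) (mu := mu)); last 5 first.
- exact: measurable_indic.
- by [].
- by move=> A mA; rewrite integral_indic// setIC.
- apply/(measurable_restrictT _ mSB); apply: measurable_funTS.
  exact: (measurableT_comp mE mS').
- by move=> x; rewrite patchE; case: ifP => //= _; rewrite lee_fin expR_ge0.
apply: eq_integral => x _; rewrite patchE !indicE in_setI.
case: (x \in S @^-1` B) => /=; last by rewrite andbF !mul0e.
by rewrite andbT muleC.
Qed.

Definition cone (C : set T) : Prop := forall a x, (0 < a)%R -> C (delta a x) <-> C x.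

(** The dilation with factor [1 / sqrt r] maps the ball of squared radius [r]
    to the unit ball and preserves the cone. *)
Lemma radial_ray C (mC : measurable C) r : cone C -> (0 < r)%R ->
  radial mC `]-oo, r[%classic =
  (Num.sqrt r ^+ q.+1)%:E * radial mC `]-oo, 1%R[%classic.
Proof.
move=> coneC r0; have mray (u : R) : measurable (`]-oo, u[%classic : set mR).
  exact: (measurable_itv `]-oo, u[).
rewrite (radialE mC (mray r)) (radialE mC (mray 1%R)).
have sr0 : (0 < Num.sqrt r)%R by rewrite sqrtr_gt0.
have mF : measurable_fun setT
    (fun x => (\1_(C `&` S @^-1` `]-oo, 1%R[%classic) x)%:E : \bar R).
  apply/measurable_EFinP; apply: measurable_indic; apply: measurableI => //.
  by rewrite -[X in measurable X]setTI; exact: mS.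
rewrite -[X in (X ^+ _)%:E]invrK -homogeneous ?invr_gt0//.
apply: eq_integral => x _; congr (_%:E * _); rewrite !indicE; congr (_%:R).
congr nat_of_bool; apply/idP/idP; rewrite !inE => -[Cx Sx]; split.
- by apply/coneC; rewrite ?invr_gt0.
- move: Sx; rewrite /= !in_itv/= S_delta ?invr_gt0// exprVn sqr_sqrtr ?ltW//.
  by rewrite mulrC ltr_pdivrMr// mul1r.
- by move/coneC : Cx; apply; rewrite invr_gt0.
- move: Sx; rewrite /= !in_itv/= S_delta ?invr_gt0// exprVn sqr_sqrtr ?ltW//.
  by rewrite mulrC ltr_pdivrMr// mul1r.
Qed.

Lemma radial_ray1_lty C (mC : measurable C) : radial mC `]-oo, 1%R[%classic < +oo.
Proof.
rewrite radialE; last exact: (measurable_itv `]-oo, 1%R[).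
apply: (@le_lt_trans _ _ (\int[mu]_x (expR (1 / 2))%:E)).
  apply: ge0_le_integral => //.
  - apply: emeasurable_funM.
      apply/measurable_EFinP; apply: measurable_indic; apply: measurableI => //.
      by rewrite -[X in measurable X]setTI; exact: mS.
    apply/measurable_EFinP; apply: measurableT_comp => //.
    exact: measurable_funM.
  - move=> x _; rewrite indicE; case: (boolP (_ \in _)) => /=; last first.
      by rewrite mul0e lee_fin expR_ge0.
    rewrite inE => -[_ /=]; rewrite in_itv/= mul1e lee_fin ler_expR => Sx.
    by rewrite ler_pM2r// ltW.
rewrite (integral_cst mu measurableT).
apply: lte_mul_pinfty => //.
by apply: (@le_lt_trans _ _ 1); [exact: probability_le1|exact: ltry].
Qed.

Lemma le_radial C (mC : measurable C) B : measurable B ->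
  radial mC B <= radial measurableT B.
Proof.
move=> mB; rewrite !radialE//.
have mI D : measurable D -> measurable_fun setT
    (fun x : T => (\1_D x)%:E * (expR (S x / 2))%:E).
  move=> mD; apply: emeasurable_funM.
    by apply/measurable_EFinP; apply: measurable_indic.
  apply/measurable_EFinP; apply: measurableT_comp => //.
  exact: measurable_funM.
have mSB : measurable (S @^-1` B) by rewrite -[X in measurable X]setTI; exact: mS.
apply: ge0_le_integral => //.
- by apply: mI; exact: measurableI.
- by apply: mI; exact: measurableI.
- move=> x _; apply: lee_wpmul2r; first by rewrite lee_fin expR_ge0.
  rewrite lee_fin !indicE setTI in_setI; by case: (x \in C).
Qed.

(** By homogeneity the mass of the ball of squared radius [t ^ 2] tends to [0]
    with [t]. *)
Lemma radial_le0 : radial measurableT `]-oo, 0%R]%classic = 0.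
Proof.
have coneT : cone setT by [].
pose b := fine (radial measurableT `]-oo, 1%R[%classic).
have bE : radial measurableT `]-oo, 1%R[%classic = b%:E.
  by rewrite fineK// ge0_fin_numE ?radial_ray1_lty.
have b0 : (0 <= b)%R by rewrite -lee_fin -bE.
apply/eqP; rewrite eq_le measure_ge0 andbT; apply/lee_addgt0Pr => e e0.
(* The mass is at most t * b for t <= 1, and b may vanish. *)
rewrite add0e; pose t := Num.min 1%R (e / (b + 1))%R.
have t0 : (0 < t)%R by rewrite lt_min ltr01 divr_gt0// ltr_wpDl.
apply: (@le_trans _ _ (radial measurableT `]-oo, (t ^+ 2)%R[%classic)).
  apply: le_measure; rewrite ?inE//.
  by move=> z /=; rewrite !in_itv/= => /le_lt_trans; apply; rewrite exprn_gt0.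
rewrite radial_ray ?exprn_gt0// bE sqrtr_sqr gtr0_norm// -EFinM lee_fin.
apply: (@le_trans _ _ (t * b)%R).
  rewrite ler_wpM2r// exprS -[leRHS]mulr1 ler_wpM2l ?(ltW t0)//.
  by rewrite exprn_ile1 ?(ltW t0)// /t ge_min lexx.
have b1 : (0 < b + 1)%R by rewrite ltr_wpDl.
apply: (@le_trans _ _ (e / (b + 1) * b)%R).
  by rewrite ler_wpM2r// /t ge_min lexx orbT.
by rewrite mulrAC ler_pdivrMr// ler_wpM2l ?(ltW e0)// lerDl.
Qed.

(** Removing the weight [exp (S / 2)] gives back the distribution of [S] in
    [C]. *)
Lemma radialK C (mC : measurable C) B : measurable B ->
  \int[radial mC]_(s in B) (expR (- (s / 2)))%:E = mu (C `&` S @^-1` B).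
Proof.
move=> mB; have mSB : measurable (S @^-1` B).
  by rewrite -[X in measurable X]setTI; exact: mS.
rewrite integral_mkcond.
rewrite (integral_density (f := expR_half)
    (mu := image_measure (mrestr mu mC) mS')); last 5 first.
- exact: measurable_expR_half.
- exact: expR_half_ge0.
- by [].
- apply/(measurable_restrictT _ mB); apply: measurable_funTS.
  apply/measurable_EFinP; apply: measurableT_comp => //.
  by apply: measurableT_comp => //; exact: measurable_funM.
- by move=> x; rewrite patchE; case: ifP => //= _; rewrite lee_fin expR_ge0.
rewrite (eq_integral (fun s => (\1_B s)%:E)); last first.
  move=> s _; rewrite patchE indicE; case: ifP => _; last by rewrite mul0e.
  by rewrite -EFinM -expRD addNr expR0.
by rewrite integral_indic// setIT setIC.
Qed.

Lemma polar_le0 : mu [set x | (S x <= 0)%R] = 0.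
Proof.
have mi : measurable (`]-oo, 0%R]%classic : set mR) by exact: (measurable_itv `]-oo, 0%R]).
have := radialK measurableT mi; rewrite setTI.
rewrite (_ : S @^-1` _ = [set x | (S x <= 0)%R]); last first.
  by apply/funext => x /=; rewrite in_itv.
move=> <-; apply: null_set_integral => //; last exact: radial_le0.
apply: measurable_funTS; apply/measurable_EFinP; apply: measurableT_comp => //.
by apply: measurableT_comp => //; exact: measurable_funM.
Qed.

(** By [radial_ray], the radial measures of [C] and of the whole space are
    proportional on rays, hence proportional; removing the weight, so are the
    distributions of [S] in [C] and in the whole space. *)
Lemma polar_independence C B : measurable C -> cone C -> measurable B ->
  mu (C `&` S @^-1` B) = mu C * mu (S @^-1` B).
Proof.
move=> mC coneC mB; have coneT : cone setT by [].
have mray (u : R) : measurable (`]-oo, u[%classic : set mR).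
  exact: (measurable_itv `]-oo, u[).
pose a := fine (radial mC `]-oo, 1%R[%classic).
pose b := fine (radial measurableT `]-oo, 1%R[%classic).
have aE : radial mC `]-oo, 1%R[%classic = a%:E.
  by rewrite fineK// ge0_fin_numE ?radial_ray1_lty.
have bE : radial measurableT `]-oo, 1%R[%classic = b%:E.
  by rewrite fineK// ge0_fin_numE ?radial_ray1_lty.
have a0 : (0 <= a)%R by rewrite -lee_fin -aE.
have b0 : (0 <= b)%R by rewrite -lee_fin -bE.
have ray0 r : (r <= 0)%R -> radial measurableT `]-oo, r[%classic = 0.
  move=> r0; apply/eqP; rewrite eq_le measure_ge0 andbT -radial_le0.
  apply: le_measure; rewrite ?inE//.
  by move=> z /=; rewrite !in_itv/= => /ltW/le_trans; apply.
have rayC0 r : (r <= 0)%R -> radial mC `]-oo, r[%classic = 0.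
  move=> r0; apply/eqP; rewrite eq_le measure_ge0 andbT -(ray0 r r0).
  exact: le_radial.
(* Otherwise the radial measure of the whole space vanishes, although mu is
   recovered from it. *)
have b_neq0 : b != 0%R.
  apply/eqP => b00; have := @probability_setT _ _ _ mu.
  have := radialK measurableT measurableT.
  rewrite preimage_setT setTI (eq_measure_integral mzero) => [|A mA _].
    by rewrite integral_measure_zero => <- /eqP; rewrite lt_eqF.
  apply: measure_ray_unique mA => r; have [r0|r0] := ltP 0%R r.
  - by rewrite radial_ray// bE b00 mule0.
  - by rewrite ray0.
  - by rewrite radial_ray// bE b00 mule0.
  - by rewrite ray0.
have prop A : measurable A ->
    mscale (NngNum b0) (radial mC) A = mscale (NngNum a0) (radial measurableT) A.
  apply: measure_ray_unique => r.
    change (b%:E * radial mC `]-oo, r[%classic < +oo).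
    have [r0|r0] := ltP 0%R r; first by rewrite radial_ray// aE -!EFinM ltry.
    by rewrite rayC0// mule0.
  change (b%:E * radial mC `]-oo, r[%classic =
    a%:E * radial measurableT `]-oo, r[%classic).
  have [r0|r0] := ltP 0%R r; last by rewrite rayC0// ray0// !mule0.
  rewrite (radial_ray mC coneC r0) (radial_ray measurableT coneT r0) aE bE.
  by rewrite -!EFinM; congr (_%:E); ring.
have mE D : measurable_fun D (fun s : mR => (expR (- (s / 2)))%:E).
  apply: measurable_funTS; apply/measurable_EFinP; apply: measurableT_comp => //.
  by apply: measurableT_comp => //; exact: measurable_funM.
have key A : measurable A ->
    b%:E * mu (C `&` S @^-1` A) = a%:E * mu (S @^-1` A).
  move=> mA; rewrite -(radialK mC mA) -[S @^-1` A]setTI -(radialK measurableT mA).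
  have := @ge0_integral_mscale _ _ _ (radial mC) _ mA (NngNum b0) _ (mE A).
  move=> <-; last by move=> x _; rewrite lee_fin expR_ge0.
  have := @ge0_integral_mscale _ _ _ (radial measurableT) _ mA (NngNum a0) _ (mE A).
  move=> <-; last by move=> x _; rewrite lee_fin expR_ge0.
  by apply: eq_measure_integral => D mD _; exact: prop.
(* The whole line in place of B determines the factor of proportionality. *)
have := key _ measurableT; rewrite preimage_setT setIT probability_setT mule1 => aE'.
have := key _ mB; rewrite -aE' => /(congr1 (fun x => b^-1%:E * x)).
by rewrite !muleA -!EFinM mulVf// !mul1e.
Qed.

End polar.

(** * The chi-squared law *)

Section chi2.
Local Open Scope ereal_scope.
Context {R : realType}.
Notation mR := (measurableTypeR R).
Notation N := (@normal_prob R 0 1).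
Notation chi2 := (@chi2_prob R).

Definition dilation (a : R) (p : mR * mR) : mR * mR :=
  ((a * p.1)%R, (a ^+ 2 * p.2)%R).

Lemma measurable_dilation a : measurable_fun setT (dilation a).
Proof.
by apply/measurable_fun_pair; exact: (@measurable_funM _ (mR * mR)%type R).
Qed.

Lemma sqr_add_dilation a p : sqr_add (dilation a p) = (a ^+ 2 * sqr_add p)%R.
Proof. by rewrite /sqr_add/= exprMn mulrDr. Qed.

Lemma integral_chi2S m (g : mR -> \bar R) : measurable_fun setT g ->
  (forall x, 0 <= g x) ->
  \int[chi2 m.+1]_v g v = \int[N \x chi2 m]_p g (sqr_add p).
Proof.
move=> mg g0.
exact: (ge0_integral_pushforward measurable_sqr_add _ measurableT mg
  (fun x _ => g0 x)).
Qed.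

Let mexp2 : measurable_fun [set: mR] (fun v => (expR (v / 2))%:E).
Proof.
by apply/measurable_EFinP; apply: measurableT_comp => //; exact: measurable_funM.
Qed.

Let mexpX2 : measurable_fun [set: mR] (fun v => (expR ((v : R) ^+ 2 / 2))%:E).
Proof.
apply/measurable_EFinP; apply: measurableT_comp => //.
by apply: measurable_funM => //; exact: measurable_funX.
Qed.

Let mexpS : measurable_fun [set: mR * mR] (fun p => (expR (sqr_add p / 2))%:E).
Proof. exact: (measurableT_comp mexp2 measurable_sqr_add). Qed.

Lemma normal_chi2_weightE m (F : mR * mR -> \bar R) :
  measurable_fun setT F -> (forall p, 0 <= F p) ->
  \int[N \x chi2 m]_p (F p * (expR (sqr_add p / 2))%:E) =
  \int[chi2 m]_v ((\int[N]_z (F (z, v) * (expR (z ^+ 2 / 2))%:E)) *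
    (expR (v / 2))%:E).
Proof.
move=> mF F0; rewrite fubini_tonelli2; last 2 first.
- exact: emeasurable_funM.
- by move=> p; rewrite mule_ge0// lee_fin expR_ge0.
apply: eq_integral => v _; rewrite /fubini_G.
rewrite -ge0_integralZr; last 4 first.
- exact: measurableT.
- by apply: emeasurable_funM => //; exact: measurable_fun_pair1.
- by move=> z _; rewrite mule_ge0// lee_fin expR_ge0.
- by rewrite lee_fin expR_ge0.
by apply: eq_integral => z _; rewrite /sqr_add/= mulrDl expRD EFinM muleA.
Qed.

Let measurable_weight (F : mR * mR -> \bar R) : measurable_fun setT F ->
  (forall p, 0 <= F p) ->
  measurable_fun setT (fun v => \int[N]_z (F (z, v) * (expR (z ^+ 2 / 2))%:E)).
Proof.
move=> mF F0.
have mG : measurable_fun setT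
    (fun p : mR * mR => F p * (expR ((p.1 : R) ^+ 2 / 2))%:E).
  apply: emeasurable_funM => //; exact: (measurableT_comp mexpX2).
apply: (measurable_fun_fubini_tonelli_G _ mG).
by move=> p; rewrite mule_ge0// lee_fin expR_ge0.
Qed.

Definition chi2_homogeneous_at m := forall a (g : mR -> \bar R), (0 < a)%R ->
  measurable_fun setT g -> (forall v, 0 <= g v) ->
  \int[chi2 m]_v (g (a ^+ 2 * v)%R * (expR (v / 2))%:E) =
  (a^-1 ^+ m)%:E * \int[chi2 m]_v (g v * (expR (v / 2))%:E).

(** The first coordinate contributes one factor [1 / a] and the second one [m]
    factors. *)
Let homogeneous_pair m : chi2_homogeneous_at m ->
  forall a (F : mR * mR -> \bar R), (0 < a)%R ->
  measurable_fun setT F -> (forall p, 0 <= F p) ->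
  \int[N \x chi2 m]_p (F (dilation a p) * (expR (sqr_add p / 2))%:E) =
  (a^-1 ^+ m.+1)%:E * \int[N \x chi2 m]_p (F p * (expR (sqr_add p / 2))%:E).
Proof.
move=> chiH a F a0 mF F0.
rewrite (@normal_chi2_weightE m (fun p => F (dilation a p))); last 2 first.
- exact: (measurableT_comp mF (measurable_dilation a)).
- by move=> p; exact: F0.
rewrite normal_chi2_weightE// exprS EFinM -muleA.
pose H v := \int[N]_z (F (z, v) * (expR (z ^+ 2 / 2))%:E).
have mH : measurable_fun setT H by exact: measurable_weight.
have H0 v : 0 <= H v.
  by apply: integral_ge0 => z _; rewrite mule_ge0// lee_fin expR_ge0.
rewrite -(chiH a H a0 mH H0).
rewrite -ge0_integralZl; last 4 first.
- exact: measurableT.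
- apply: emeasurable_funM => //; apply: (measurableT_comp mH).
  exact: measurable_funM.
- by move=> v _; rewrite mule_ge0// lee_fin expR_ge0.
- by rewrite lee_fin invr_ge0 ltW.
apply: eq_integral => v _; rewrite muleA; congr (_ * _).
rewrite /dilation/=.
rewrite (std_normal_homogeneous (g := fun z => F (z, (a ^+ 2 * v)%R)))//.
exact: measurable_fun_pair1.
Qed.

(** Homogeneity passes through the recursion by which the chi-squared law is
    defined, since [sqr_add] intertwines the dilations of the plane with those
    of the line. *)
Lemma chi2_homogeneous m : chi2_homogeneous_at m.
Proof.
elim: m => [|m IH] a g a0 mg g0.
  have H (h : mR -> \bar R) : measurable_fun setT h -> \int[chi2 0]_v h v = h 0%R.
    by move=> mh; rewrite (integral_dirac _ measurableT)// diracT mul1e.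
  rewrite !H ?expr0 ?mul1e ?mulr0//; first exact: emeasurable_funM.
  apply: emeasurable_funM => //; apply: (measurableT_comp mg).
  exact: measurable_funM.
have mga : measurable_fun setT (fun v => g (a ^+ 2 * v)%R).
  by apply: (measurableT_comp mg); exact: measurable_funM.
rewrite !integral_chi2S; last 4 first.
- exact: emeasurable_funM.
- by move=> v; rewrite mule_ge0// lee_fin expR_ge0.
- exact: emeasurable_funM.
- by move=> v; rewrite mule_ge0// lee_fin expR_ge0.
rewrite -(homogeneous_pair IH (F := fun p => g (sqr_add p)))//; last first.
  exact: (measurableT_comp mg measurable_sqr_add).
by apply: eq_integral => p _; rewrite sqr_add_dilation.
Qed.

Lemma normal_chi2_homogeneous m a (F : mR * mR -> \bar R) : (0 < a)%R ->
  measurable_fun setT F -> (forall p, 0 <= F p) ->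
  \int[N \x chi2 m]_p (F (dilation a p) * (expR (sqr_add p / 2))%:E) =
  (a^-1 ^+ m.+1)%:E * \int[N \x chi2 m]_p (F p * (expR (sqr_add p / 2))%:E).
Proof. exact: homogeneous_pair (@chi2_homogeneous m) a F. Qed.

(** The law of [sqr_add] is the next chi-squared law, so this is the
    independence of a cone from the squared radius. *)
Lemma normal_chi2_cone m C B : measurable C -> cone dilation C -> measurable B ->
  (N \x chi2 m) (C `&` sqr_add @^-1` B) = (N \x chi2 m) C * chi2 m.+1 B.
Proof.
move=> mC coneC mB.
apply: (@polar_independence _ _ _ (normal_prob 0 1 \x chi2_prob m)%E
  sqr_add dilation m) => //.
- exact: measurable_sqr_add.
- by move=> a p _; exact: sqr_add_dilation.
- by move=> a F a0 mF F0; exact: normal_chi2_homogeneous.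
Qed.

Lemma chi2_le0 m : chi2 m.+1 [set v : R | (v <= 0)%R] = 0.
Proof.
apply: (@polar_le0 _ _ _ (normal_prob 0 1 \x chi2_prob m)%E
  sqr_add dilation m) => //.
- exact: measurable_sqr_add.
- by move=> a p _; exact: sqr_add_dilation.
- by move=> a F a0 mF F0; exact: normal_chi2_homogeneous.
Qed.

End chi2.

(** * Independence along a sequence of normal variables *)

Section cone_chain.
Local Open Scope ereal_scope.
Context d (T : measurableType d) (R : realType) (P : probability T R).
Notation mR := (measurableTypeR R).
Notation N := (@normal_prob R 0 1).
Notation chi2 := (@chi2_prob R).

(** [V] stands for the sum of the squares of the variables already treated. The
    first cone event is moved into [G], and [X 0 ^ 2 + V], of which it is
    independent by [normal_chi2_cone], takes the place of [V]. *)
Lemma cone_chain n m G (V : T -> R) (X : nat -> T -> R)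
    (C : nat -> set (mR * mR)) :
  measurable G -> measurable_fun setT V ->
  (forall i, (i < n)%N -> measurable_fun setT (X i)) ->
  (forall (B : set R) (A : nat -> set R), measurable B ->
     (forall i, measurable (A i)) ->
     P (G `&` (V @^-1` B `&` \bigcap_(i < n) (X i @^-1` A i))) =
     P G * (chi2 m B * \prod_(i < n) N (A i))) ->
  (forall i, measurable (C i)) -> (forall i, cone dilation (C i)) ->
  P (G `&` \bigcap_(i < n)
       [set w | C i (X i w, (V w + \sum_(j < i) X j w ^+ 2)%R)]) =
  P G * \prod_(i < n) (N \x chi2 (m + i)) (C i).
Proof.
elim: n m G V X C => [|n IH] m G V X C mG mV mX PVX mC coneC.
  rewrite big_ord0 mule1 (_ : \bigcap_(i < 0) _ = setT) ?setIT//.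
  by apply/seteqP; split.
have mX0 : measurable_fun setT (X 0%N) by exact: mX.
have mA0 (A : set R) : measurable A -> measurable (X 0%N @^-1` A).
  by move=> mA; rewrite -[X in measurable X]setTI; exact: mX0.
pose H (A : nat -> set R) := G `&` \bigcap_(i < n) (X i.+1 @^-1` A i).
have mH A : (forall i, measurable (A i)) -> measurable (H A).
  move=> mA; apply: measurableI => //; apply: bigcap_measurableType => // i ni.
  by rewrite -[X in measurable X]setTI; exact: mX.
have PHjoint A : (forall i, measurable (A i)) ->
    forall (A0 B : set mR), measurable A0 -> measurable B ->
    P (H A `&` (X 0%N @^-1` A0 `&` V @^-1` B)) =
    P G * \prod_(i < n) N (A i) * (N A0 * chi2 m B).
  move=> mA A0 B mA0' mB.
  have := PVX B (fun i => if i is j.+1 then A j else A0) mB.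
  rewrite bigcap_mkord_recl big_ord_recl/= => PE.
  rewrite -muleA [\prod_(i < n) _ * _]muleC -muleA [N A0 * _]muleCA -PE; last by case.
  by congr (P _); apply/seteqP; split=> [w [[? ?] [? ?]]|w [? [? [? ?]]]]; do !split.
have PH A : (forall i, measurable (A i)) -> P (H A) = P G * \prod_(i < n) N (A i).
  move=> mA; have := PHjoint A mA _ _ measurableT measurableT.
  by rewrite !preimage_setT !setIT !probability_setT !mule1.
pose G' := G `&` [set w | C 0%N (X 0%N w, V w)].
have mXV : measurable_fun setT (fun w => (X 0%N w : mR, V w : mR)).
  exact: measurable_fun_pair.
have mCS B : measurable B -> measurable (C 0%N `&` sqr_add @^-1` B).
  move=> mB; apply: measurableI; first exact: mC.
  by rewrite -[X in measurable X]setTI; exact: measurable_sqr_add.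
pose V' w : R := sqr_add (X 0%N w, V w).
have mV' : measurable_fun setT V' by exact: (measurableT_comp measurable_sqr_add mXV).
have PG'A (B : set mR) A : measurable B -> (forall i, measurable (A i)) ->
    P (G' `&` (V' @^-1` B `&` \bigcap_(i < n) (X i.+1 @^-1` A i))) =
    P G * \prod_(i < n) N (A i) * ((N \x chi2 m) (C 0%N) * chi2 m.+1 B).
  move=> mB mA; rewrite -(normal_chi2_cone m (mC 0%N) (coneC 0%N) mB) -PH//.
  have PHj : forall A0 B0 : set mR, measurable A0 -> measurable B0 ->
      P (H A `&` (X 0%N @^-1` A0 `&` V @^-1` B0)) = P (H A) * (N A0 * chi2 m B0).
    by move=> A0 B0 mA0' mB0; rewrite PH// PHjoint.
  have := @joint_law _ _ _ T mR mR R P (normal_prob 0 1) (chi2_prob m) (H A)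
    (X 0%N) V (mH A mA) mX0 mV PHj _ (mCS B mB).
  move=> <-; congr (P _); apply/seteqP.
  by split=> [w [[? ?] [? ?]]|w [[? ?] [? ?]]]; do !split.
have PG' : P G' = P G * (N \x chi2 m) (C 0%N).
  have := PG'A setT (fun=> setT) measurableT (fun=> measurableT).
  rewrite preimage_setT setTI big1; last by move=> i _; exact: probability_setT.
  rewrite (_ : \bigcap_(i < n) _ = setT); last by apply/seteqP; split.
  by rewrite setIT !mule1 (_ : chi2 m.+1 setT = 1) ?mule1//; exact: probability_setT.
have mG' : measurable G'.
  apply: measurableI => //; rewrite -[X in measurable X]setTI.
  by apply: mXV => //; exact: mC.
rewrite bigcap_mkord_recl big_ord_recl addn0.
have -> : [set w | C 0%N (X 0%N w, (V w + \sum_(j < 0) X j w ^+ 2)%R)] =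
    [set w | C 0%N (X 0%N w, V w)].
  by apply/funext => w; rewrite /= big_ord0 addr0.
rewrite setIA -/G' muleA -PG'.
rewrite (eq_bigcapr (G := fun i => [set w | (C \o succn) i ((X \o succn) i w,
    (V' w + \sum_(j < i) (X \o succn) j w ^+ 2)%R)])); last first.
  move=> i _; apply/funext => w; rewrite /= big_ord_recl /V' /sqr_add/=.
  by rewrite addrA [(_ + V w)%R]addrC.
rewrite (IH m.+1)//.
- by congr (_ * _); apply: eq_bigr => i _; rewrite addSnnS.
- by move=> i ni; exact: mX.
- move=> B A mB mA; rewrite PG'A// PG' -!muleA; congr (_ * _).
  by rewrite muleC -muleA.
- by move=> i; exact: mC.
- by move=> i; exact: coneC.
Qed.

End cone_chain.

(** * Upper quantiles of atomless laws *)

Section quantile.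
Local Open Scope ereal_scope.
Context {R : realType}.
Notation mR := (measurableTypeR R).
Variable Q : probability mR R.

Let idTR : mR -> R := idfun.
#[local] HB.instance Definition _ :=
  @isMeasurableFun.Build _ _ _ _ idTR (@measurable_id _ _ setT).
Let tail (t : R) : \bar R := Q `]t, +oo[%classic.

(** The tail is right continuous, hence at most [delta] at the supremum of the
    points where it is at least [delta]; as there are no atoms, it is also left
    continuous. *)
Lemma atomless_quantile (delta : R) : (forall t : R, Q [set t] = 0) ->
  (0 < delta < 1)%R -> exists t : R, Q `]t, +oo[%classic = delta%:E.
Proof.
move=> Q1 /andP[d0 d1].
have tail_ni a b : (a <= b)%R -> tail b <= tail a.
  by move=> ab; exact: (ccdf_nonincreasing (idTR : {RV Q >-> R}) ab).
pose A := [set t : R | delta%:E <= tail t].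
have A0 : A !=set0.
  apply: contrapT => An; have : 1%:E <= delta%:E.
    apply: (cvge_le _ (cvg_ccdfNy1 (idTR : {RV Q >-> R}))); apply: nearW => t.
    by rewrite leNgt; apply/negP => dt; apply: An; exists t; exact: ltW.
  by rewrite lee_fin leNgt d1.
have [M tailM] : exists M, tail M < delta%:E.
  apply: contrapT => An; have : delta%:E <= 0%:E.
    apply: (cvge_ge _ (cvg_ccdfy0 (idTR : {RV Q >-> R}))); apply: nearW => t.
    by rewrite leNgt; apply/negP => dt; apply: An; exists t.
  by rewrite lee_fin leNgt d0.
have supA : has_sup A.
  split=> //; exists M => t At; rewrite leNgt; apply/negP => /ltW/tail_ni.
  by move=> /(le_trans At); rewrite leNgt tailM.
exists (sup A); apply/eqP; rewrite eq_le; apply/andP; split.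
  have rc : ccdf (idTR : {RV Q >-> R}) x @[x --> (sup A)^'+] --> tail (sup A).
    exact: ccdf_right_continuous.
  apply: (cvge_le _ rc).
  near=> t; rewrite leNgt; apply/negP => dt.
  have : (t <= sup A)%R by apply: ub_le_sup; [exact: supA.2|exact: ltW].
  by rewrite leNgt; apply/negP; rewrite negbK; near: t; exact: nbhs_right_gt.
have -> : Q `]sup A, +oo[%classic = Q `[sup A, +oo[%classic.
  rewrite (_ : `[sup A, +oo[%classic = [set sup A] `|` `]sup A, +oo[%classic); last first.
    apply/seteqP; split => [z|z /= [->|]]; rewrite /= !in_itv/= !andbT//.
      by rewrite le_eqVlt => /predU1P[->|]; [left|right].
    exact: ltW.
  rewrite measureU; first by rewrite [X in _ = X + _]Q1 add0e.
  - exact: measurable_set1.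
  - exact: (measurable_itv `]sup A, +oo[).
  - by apply/seteqP; split => // z [/= ->]; rewrite in_itv/= ltxx.
rewrite itvcyEbigcap.
have : Q \o (fun k => `]sup A - k.+1%:R^-1, +oo[%classic)%R @ \oo -->
    Q (\bigcap_k `]sup A - k.+1%:R^-1, +oo[%classic)%R.
  apply: nonincreasing_cvg_mu.
  - by apply: (@le_lt_trans _ _ 1); [exact: probability_le1|exact: ltry].
  - by move=> k; exact: (measurable_itv `]_, +oo[).
  - by rewrite -itvcyEbigcap; exact: (measurable_itv `[sup A, +oo[).
  - move=> k l kl; apply/subsetPset => z /=; rewrite !in_itv/= !andbT.
    by apply: le_lt_trans; rewrite lerB// lef_pV2 ?posrE// ler_nat.
move=> /(cvge_ge _); apply; apply: nearW => k /=.
have /sup_gt -/(_ A0)[] : (sup A - k.+1%:R^-1 < sup A)%R.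
  by rewrite ltrBlDr ltrDl invr_gt0.
by move=> t At /ltW /tail_ni; exact: le_trans.
Unshelve. all: by end_near.
Qed.

End quantile.

(** * Student's law *)

Section student.
Local Open Scope ereal_scope.
Context {R : realType}.
Notation mR := (measurableTypeR R).
Notation N := (@normal_prob R 0 1).
Notation chi2 := (@chi2_prob R).

Lemma ysection_set (A : set (mR * mR)) (v : mR) :
  ysection A v = [set z | A (z, v)].
Proof. by apply/seteqP; split => z; rewrite /ysection/= inE. Qed.

Lemma normal_chi2_section m (A : set (mR * mR)) : measurable A ->
  (N \x chi2 m) A = \int[chi2 m]_v N (ysection A v).
Proof.
move=> mA.
have m1A : measurable_fun setT (fun p : mR * mR => (\1_A p)%:E : \bar R).
  by apply/measurable_EFinP; exact: measurable_indic.
transitivity (\int[N \x chi2 m]_p (\1_A p)%:E).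
  by rewrite (integral_indic _ measurableT mA) setIT.
rewrite (fubini_tonelli2 _ m1A); last by move=> p; rewrite lee_fin.
apply: eq_integral => v _; rewrite /fubini_G.
transitivity (\int[N]_z (\1_(ysection A v) z)%:E).
  apply: eq_integral => z _; rewrite !indicE ysection_set.
  by congr (_%:R%:E); congr nat_of_bool; apply/idP/idP; rewrite !inE.
by rewrite (integral_indic _ measurableT (measurable_ysection v mA)) setIT.
Qed.

(** The second coordinate is positive almost surely, so only the sections at
    positive heights matter. This excludes the division by zero in
    [t_ratio]. *)
Lemma normal_chi2_eq m (A B : set (mR * mR)) : measurable A -> measurable B ->
  (forall v : R, (0 < v)%R -> N [set z | A (z, v)] = N [set z | B (z, v)]) ->
  (N \x chi2 m.+1) A = (N \x chi2 m.+1) B.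
Proof.
move=> mA mB AB; rewrite (normal_chi2_section _ mA) (normal_chi2_section _ mB).
apply: ae_eq_integral => //.
- exact: (measurable_fun_ysection (normal_prob 0 1) mA).
- exact: (measurable_fun_ysection (normal_prob 0 1) mB).
exists [set v : R | (v <= 0)%R]; split.
- rewrite (_ : [set v | _] = `]-oo, 0%R]%classic).
    exact: (measurable_itv `]-oo, 0%R]).
  by apply/funext => v; rewrite /= in_itv.
- exact: chi2_le0.
move=> v /=; apply: contra_notP => /negP; rewrite -ltNge => v0 _.
by rewrite !ysection_set AB.
Qed.

Lemma std_normal_set1 (x : R) : N [set x] = 0.
Proof.
by apply: null_set_integral; [|apply: measurable_funTS; apply/measurable_EFinP;
  exact: measurable_normal_pdf|exact: lebesgue_measure_set1].
Qed.

Variable m : nat.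
Notation T := (@t_prob R m.+1).

Let measurable_ratio (A : set mR) : measurable A -> measurable (t_ratio m.+1 @^-1` A).
Proof. by move=> mA; rewrite -[X in measurable X]setTI; exact: measurable_t_ratio. Qed.

Let scale_gt0 (v : R) : (0 < v)%R -> (0 < Num.sqrt (v / m.+1%:R))%R.
Proof. by move=> v0; rewrite sqrtr_gt0 divr_gt0. Qed.

Lemma t_prob_set1 (t : R) : T [set t] = 0.
Proof.
transitivity ((N \x chi2 m.+1) (t_ratio m.+1 @^-1` [set t])) => //.
transitivity ((N \x chi2 m.+1) set0); last exact: measure0.
apply: normal_chi2_eq; [exact: measurable_ratio|exact: measurable0|].
move=> v v0; rewrite [RHS](_ : _ = 0); last exact: measure0.
rewrite (_ : [set z | _] = [set (t * Num.sqrt (v / m.+1%:R))%R]).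
  exact: std_normal_set1.
apply/seteqP; split => z /=; rewrite /t_ratio/=.
  by move=> <-; rewrite divfK// gt_eqF ?scale_gt0.
by move=> ->; rewrite mulfK// gt_eqF ?scale_gt0.
Qed.

Lemma t_probN (t : R) : T `]-oo, (- t)%R]%classic = T `[t, +oo[%classic.
Proof.
have mray1 : measurable (`]-oo, (- t)%R]%classic : set mR).
  exact: (measurable_itv `]-oo, (- t)%R]).
have mray2 : measurable (`[t, +oo[%classic : set mR) by exact: (measurable_itv `[t, +oo[).
apply: normal_chi2_eq; try exact: measurable_ratio.
move=> v v0; rewrite -[RHS]std_normalN; last first.
  have := measurable_ysection (v : mR) (measurable_ratio mray2).
  by rewrite ysection_set.
congr (N _); apply/funext => z; rewrite /= !in_itv/= /t_ratio/= andbT.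
by rewrite mulNr lerNr.
Qed.

Lemma t_prob_ray (t : R) : T `[t, +oo[%classic = T `]t, +oo[%classic.
Proof.
rewrite (_ : `[t, +oo[%classic = [set t] `|` `]t, +oo[%classic); last first.
  apply/seteqP; split => [z|z /= [->|]]; rewrite /= !in_itv/= !andbT//.
    by rewrite le_eqVlt => /predU1P[->|]; [left|right].
  exact: ltW.
rewrite measureU; first by rewrite [X in X + _]t_prob_set1 add0e.
- exact: measurable_set1.
- exact: (measurable_itv `]t, +oo[).
- by apply/seteqP; split => // z [/= ->]; rewrite in_itv/= ltxx.
Qed.

Lemma t_prob_rays (t : R) : (0 <= t)%R ->
  T (`]-oo, (- t)%R]%classic `|` `]t, +oo[%classic) =
  T `]t, +oo[%classic + T `]t, +oo[%classic.
Proof.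
move=> t0.
have m1 : measurable (`]-oo, (- t)%R]%classic : set mR).
  exact: (measurable_itv `]-oo, (- t)%R]).
have m2 : measurable (`]t, +oo[%classic : set mR) by exact: (measurable_itv `]t, +oo[).
have dis : `]-oo, (- t)%R]%classic `&` `]t, +oo[%classic = set0 :> set mR.
  apply/seteqP; split => // z [/=]; rewrite !in_itv/= andbT => zt tz.
  by have := lt_le_trans tz zt; lra.
rewrite (measureU T m1 m2 dis).
exact: (congr1 (fun x => x + T `]t, +oo[%classic) (etrans (t_probN t) (t_prob_ray t))).
Qed.

Lemma t_upperP (delta : R) : (0 < delta < 1)%R ->
  T `]t_upper m.+1 delta, +oo[%classic = delta%:E.
Proof.
move=> /(atomless_quantile t_prob_set1).
exact: (@xgetPex _ 0%R [set t : R | T `]t, +oo[%classic = delta%:E]).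
Qed.

(** By symmetry the tail at [0] is [1 / 2]. *)
Lemma t_upper_gt0 (delta : R) : (0 < delta < 1 / 2)%R -> (0 < t_upper m.+1 delta)%R.
Proof.
move=> /andP[d0 d2]; have d1 : (0 < delta < 1)%R by lra.
rewrite ltNge; apply/negP => t0.
have : T `]0%R, +oo[%classic <= delta%:E.
  rewrite -(t_upperP d1); apply: le_measure; rewrite ?inE//.
  by move=> z /=; rewrite !in_itv/= !andbT; exact: le_lt_trans.
have := t_prob_rays (lexx 0%R).
rewrite oppr0 (_ : _ `|` _ = setT); last first.
  apply/seteqP; split => // z _; rewrite /= !in_itv/= andbT.
  by have [|] := leP z 0%R; [left|right].
rewrite (_ : T setT = 1); last exact: probability_setT.
have : T `]0%R, +oo[%classic \is a fin_num by exact: fin_num_measure.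
move=> /fineK <-; rewrite -EFinD lee_fin => -[]; lra.
Qed.

(** The form taken by a missed prediction, which is meaningful also when
    [p.2 = 0]. *)
Definition t_event (t : R) : set (mR * mR) :=
  [set p | (t * Num.sqrt ((p.2 : R) / m.+1%:R) <= `|p.1 : R|)%R].

Lemma measurable_t_event t : measurable (t_event t).
Proof.
have m1 : measurable_fun [set: mR * mR]
    (fun p => (t * Num.sqrt ((p.2 : R) / m.+1%:R))%R).
  apply: (@measurable_funM _ (mR * mR)%type R) => //.
  apply: (@measurableT_comp _ _ _ _ R _ (@Num.sqrt R)).
    by apply: continuous_measurable_fun; exact: sqrt_continuous.
  by apply: (@measurable_funM _ (mR * mR)%type R) => //; exact: measurable_snd.
have m2 : measurable_fun [set: mR * mR] (fun p => `|p.1 : R|%R).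
  apply: (@measurableT_comp _ _ _ _ R _ (fun x : R => `|x|%R)); last exact: measurable_fst.
  exact: normr_measurable.
have := measurable_fun_le (T := (mR * mR)%type) measurableT m1 m2.
by rewrite setTI.
Qed.

Lemma cone_t_event t : cone dilation (t_event t).
Proof.
move=> a [z v] a0; rewrite /t_event/dilation/= -mulrA sqrtrM ?sqr_ge0//.
by rewrite sqrtr_sqr gtr0_norm// mulrCA normrM gtr0_norm// ler_pM2l.
Qed.

(** At positive heights the event says that the ratio is at least [t] or at most
    [- t]; since [t > 0], these two cases exclude each other. *)
Lemma normal_chi2_t_event (eps : R) : (0 < eps < 1)%R ->
  (N \x chi2 m.+1) (t_event (t_upper m.+1 (eps / 2))) = eps%:E.
Proof.
move=> eps01; have d2 : (0 < eps / 2 < 1 / 2)%R by lra.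
have d1 : (0 < eps / 2 < 1)%R by lra.
set t := t_upper _ _; have t0 : (0 < t)%R by exact: t_upper_gt0.
transitivity (T (`]-oo, (- t)%R]%classic `|` `[t, +oo[%classic)).
  apply: normal_chi2_eq; first exact: measurable_t_event.
    apply: measurable_ratio; apply: measurableU.
      exact: (measurable_itv `]-oo, (- t)%R]).
    exact: (measurable_itv `[t, +oo[).
  move=> v v0; congr (N _); apply/funext => z; apply/propext.
  rewrite /t_event/= !in_itv/= andbT /t_ratio/= ler_normr.
  rewrite ler_pdivlMr ?scale_gt0// ler_pdivrMr ?scale_gt0// mulNr lerNr.
  by rewrite orbC; split => /orP.
have m1 : measurable (`]-oo, (- t)%R]%classic : set mR).
  exact: (measurable_itv `]-oo, (- t)%R]).
have m2 : measurable (`[t, +oo[%classic : set mR) by exact: (measurable_itv `[t, +oo[).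
have dis : `]-oo, (- t)%R]%classic `&` `[t, +oo[%classic = set0 :> set mR.
  apply/seteqP; split => // z [/=]; rewrite !in_itv/= andbT => zt tz.
  by have := le_trans tz zt; lra.
rewrite (measureU T m1 m2 dis).
have e2 := etrans (t_prob_ray t) (t_upperP d1).
have e1 := etrans (t_probN t) e2.
have e3 : eps%:E = (eps / 2)%:E + (eps / 2)%:E by rewrite -EFinD -splitr.
rewrite e3.
apply: f_equal2.
  exact e1.
exact e2.
Qed.

End student.

(** * Recursive residuals of least squares *)

Section recursive_residuals.
Context {R : realType} {K : nat} (x : nat -> 'cV[R]_K).
Hypothesis full_rank :
  forall l : nat, (1 <= l)%N -> \rank (Zmx x l) = minn l (K + 1).
Local Open Scope ring_scope.

Notation z := (zvec x).

Definition gram (l : nat) : 'M[R]_(1 + K) := (Zmx x l)^T *m Zmx x l.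

Lemma design_mulmx l n (A : 'M[R]_(l, n)) :
  (Zmx x l)^T *m A = \sum_(i < l) z i.+1 *m row i A.
Proof.
apply/matrixP => i j; rewrite !mxE summxE; apply: eq_bigr => k _.
by rewrite !mxE big_ord1 !mxE.
Qed.

Lemma gramE l : gram l = \sum_(i < l) z i.+1 *m (z i.+1)^T.
Proof.
rewrite /gram design_mulmx; apply: eq_bigr => i _; congr (_ *m _).
by apply/rowP => j; rewrite !mxE.
Qed.

Lemma gramS l : gram l.+1 = gram l + z l.+1 *m (z l.+1)^T.
Proof. by rewrite !gramE big_ord_recr. Qed.

Lemma tr_gram l : (gram l)^T = gram l.
Proof. by rewrite /gram trmx_mul trmxK. Qed.

Lemma mulmx_tr_eq0 n (u : 'rV[R]_n) : u *m u^T = 0 -> u = 0.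
Proof.
move=> /matrixP/(_ 0 0); rewrite !mxE => /eqP.
rewrite psumr_eq0 => [/allP u0|i _]; last by rewrite mxE -expr2 sqr_ge0.
apply/rowP => j; have := u0 j; rewrite mem_index_enum => /(_ isT).
by rewrite !mxE -expr2 sqrf_eq0 => /eqP.
Qed.

(** If [v] is in the kernel of the Gram matrix, the squared length of
    [v *m Z^T] is zero, and [Z^T] has independent rows. *)
Lemma gram_unit l : (K + 1 <= l)%N -> gram l \in unitmx.
Proof.
move=> Kl; rewrite -row_free_unit; apply: inj_row_free => v vM.
have : v *m (Zmx x l)^T = 0.
  apply: mulmx_tr_eq0; rewrite trmx_mul trmxK mulmxA -(mulmxA v) -/(gram l).
  by rewrite vM mul0mx.
have free : row_free (Zmx x l)^T.
  rewrite /row_free mxrank_tr full_rank; last by rewrite (leq_trans _ Kl)// addn1.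
  by rewrite (minn_idPr Kl) addnC.
by move/eqP; rewrite mulmx_free_eq0// => /eqP.
Qed.

Lemma dotC n (u v : 'cV[R]_n) : (u^T *m v) 0 0 = (v^T *m u) 0 0.
Proof. by rewrite !mxE; apply: eq_bigr => i _; rewrite !mxE mulrC. Qed.

Lemma mulmx11_00 (A B : 'M[R]_1) : (A *m B) 0 0 = A 0 0 * B 0 0.
Proof. by rewrite mxE big_ord1. Qed.

Lemma mulmx11 n (u : 'cV[R]_n) (A : 'M[R]_1) : u *m A = A 0 0 *: u.
Proof. by apply/colP => j; rewrite mxE big_ord1 [RHS]mxE mulrC !ord1. Qed.

(** The direction in which the next observation moves the estimate, see
    [gammahatS]. *)
Definition gain l : 'cV[R]_(1 + K) := invmx (gram l) *m z l.+1.

Definition leverage l i : R := ((z i.+1)^T *m gain l) 0 0.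

Lemma gram_gain l : (K + 1 <= l)%N -> gram l *m gain l = z l.+1.
Proof. by move=> Kl; rewrite /gain mulKVmx// gram_unit. Qed.

(** With [u = gain l], both sides are [u^T *m gram l *m u]. *)
Lemma sum_leverage l : (K + 1 <= l)%N ->
  \sum_(i < l) leverage l i ^+ 2 = leverage l l.
Proof.
move=> Kl; rewrite /leverage dotC -[in RHS](gram_gain Kl) gramE mulmx_suml.
rewrite mulmx_sumr summxE; apply: eq_bigr => i _.
by rewrite -mulmxA mulmxA mulmx11_00 expr2 [in RHS]dotC.
Qed.

Lemma leverage_ge0 l : (K + 1 <= l)%N -> 0 <= leverage l l.
Proof. by move=> Kl; rewrite -sum_leverage// sumr_ge0// => i _; exact: sqr_ge0. Qed.

Definition resid_scale l : R := Num.sqrt (1 + leverage l l).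

Lemma resid_scale_gt0 l : (K + 1 <= l)%N -> 0 < resid_scale l.
Proof. by move=> Kl; rewrite sqrtr_gt0 ltr_wpDr// leverage_ge0. Qed.

Lemma sqr_resid_scale l : (K + 1 <= l)%N -> resid_scale l ^+ 2 = 1 + leverage l l.
Proof. by move=> Kl; rewrite sqr_sqrtr// addr_ge0// leverage_ge0. Qed.

(** The coefficients of the labels in [recres]. They vanish beyond the index
    [l], so that all coefficient vectors can be compared in a common space of
    large dimension. *)
Definition recres_coef l i : R :=
  (if (i < l)%N then - leverage l i else (i == l)%:R) / resid_scale l.

Lemma sum_recres_coef l N (f : nat -> R) : (l < N)%N ->
  \sum_(i < N) recres_coef l i * f i =
  (f l - \sum_(i < l) leverage l i * f i) / resid_scale l.
Proof.
move=> lN; rewrite -(subnKC lN) big_split_ord/= [X in _ + X]big1 ?addr0; last first.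
  move=> i _; rewrite /recres_coef ltnNge (leq_trans (leqnSn l)) ?leq_addr//=.
  by rewrite gtn_eqF ?mul0r// ltnS leq_addr.
rewrite big_ord_recr/= {2}/recres_coef ltnn eqxx div1r mulrC addrC mulrDl.
congr (_ + _); rewrite -sumrN mulr_suml; apply: eq_bigr => i _.
by rewrite /recres_coef ltn_ord mulrAC mulNr.
Qed.

(** The coefficient vector is orthogonal to all columns of the design: the
    prediction is exact for labels that depend linearly on the regressors. *)
Lemma recres_coef_design l N (v : 'cV[R]_(1 + K)) : (K + 1 <= l)%N -> (l < N)%N ->
  \sum_(i < N) recres_coef l i * ((z i.+1)^T *m v) 0 0 = 0.
Proof.
move=> Kl lN; rewrite (@sum_recres_coef l N (fun i => ((z i.+1)^T *m v) 0 0))//.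
suff -> : \sum_(i < l) leverage l i * ((z i.+1)^T *m v) 0 0 =
    ((z l.+1)^T *m v) 0 0 by rewrite subrr mul0r.
rewrite -[in RHS](gram_gain Kl) dotC gramE mulmx_suml mulmx_sumr summxE.
apply: eq_bigr => i _.
by rewrite -mulmxA mulmxA mulmx11_00 mulrC [in RHS]dotC.
Qed.

(** If [l < l'], then on the support of the [l]-th vector the entries of the
    [l']-th one depend linearly on the regressors, so that
    [recres_coef_design] applies. The norm is computed by [sum_leverage]. *)
Lemma recres_coef_orthonormal l l' N : (K + 1 <= l)%N -> (K + 1 <= l')%N ->
  (l < N)%N -> (l' < N)%N ->
  \sum_(i < N) recres_coef l i * recres_coef l' i = (l == l')%:R.
Proof.
wlog ll' : l l' / (l <= l')%N.
  move=> H; case: (leqP l l') => [|/ltnW] ll' Kl Kl' lN l'N; first exact: H.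
  by rewrite eq_sym -H//; apply: eq_bigr => i _; rewrite mulrC.
move=> Kl Kl' lN l'N; move: ll'; rewrite leq_eqVlt => /predU1P[<-|ll'].
  rewrite eqxx (@sum_recres_coef l N (recres_coef l))// {1}/recres_coef ltnn eqxx.
  have s0 : resid_scale l != 0 by rewrite gt_eqF// resid_scale_gt0.
  rewrite (_ : \sum_(i < l) _ = - leverage l l / resid_scale l).
    rewrite -mulrBl opprK -mulrA -invfM -expr2 sqr_resid_scale//.
    by rewrite divff// -sqr_resid_scale// expf_neq0.
  rewrite -sum_leverage// -sumrN mulr_suml; apply: eq_bigr => i _.
  by rewrite /recres_coef ltn_ord mulNr mulrN mulNr mulrA expr2.
rewrite (ltn_eqF ll') (eq_bigr (fun i : 'I_N => - (resid_scale l')^-1 *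
  (recres_coef l i * ((z i.+1)^T *m gain l') 0 0))).
  by rewrite -mulr_sumr recres_coef_design// mulr0.
move=> i _; have [il|li] := leqP i l; last first.
  by rewrite {1 3}/recres_coef ltnNge (ltnW li)/= gtn_eqF// !mul0r mulr0.
rewrite {2}/recres_coef (leq_ltn_trans il ll') -/(leverage l' i).
by ring.
Qed.

Definition residual (y : nat -> R) l i : R :=
  y i.+1 - ((z i.+1)^T *m gammahat x (labels y l)) 0 0.

Definition rss y l : R := \sum_(i < l) residual y l i ^+ 2.

(** The recursive residual: the error of the prediction of the observation
    number [l + 1] from the first [l], divided by its standard deviation in
    units of that of the noise. *)
Definition recres y l : R := residual y l l / resid_scale l.

Lemma design_labels y l : (Zmx x l)^T *m labels y l = \sum_(i < l) y i.+1 *: z i.+1.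
Proof.
rewrite design_mulmx; apply: eq_bigr => i _; apply/colP => j.
by rewrite !mxE big_ord1 !mxE mulrC.
Qed.

Lemma normal_equation y l : (K + 1 <= l)%N ->
  gram l *m gammahat x (labels y l) = \sum_(i < l) y i.+1 *: z i.+1.
Proof.
by move=> Kl; rewrite /gammahat -mulmxA mulKVmx ?gram_unit// design_labels.
Qed.

Lemma recresE y l N : (K + 1 <= l)%N -> (l < N)%N ->
  recres y l = \sum_(i < N) recres_coef l i * y i.+1.
Proof.
move=> Kl lN; rewrite (@sum_recres_coef l N (fun i => y i.+1))//.
congr ((_ - _) / _); rewrite dotC -(gram_gain Kl) mulmxA -[gram l]tr_gram.
rewrite -trmx_mul normal_equation// linear_sum mulmx_suml summxE.
by apply: eq_bigr => i _; rewrite linearZ -scalemxAl mxE mulrC.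
Qed.

Lemma residual_design y l : (K + 1 <= l)%N ->
  \sum_(i < l) residual y l i *: z i.+1 = 0.
Proof.
move=> Kl; apply/eqP; under eq_bigr do rewrite scalerBl.
rewrite sumrB -normal_equation// subr_eq0 eq_sym gramE mulmx_suml; apply/eqP.
by apply: eq_bigr => i _; rewrite -mulmxA mulmx11.
Qed.

(** The right-hand side solves the normal equations for [l + 1]
    observations. *)
Lemma gammahatS y l : (K + 1 <= l)%N ->
  gammahat x (labels y l.+1) = gammahat x (labels y l) +
    (residual y l l / (1 + leverage l l)) *: gain l.
Proof.
move=> Kl; have Kl1 := leq_trans Kl (leqnSn l).
have h0 : 1 + leverage l l != 0.
  by rewrite -sqr_resid_scale// expf_neq0// gt_eqF// resid_scale_gt0.
apply: (can_inj (mulKmx (gram_unit Kl1))).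
rewrite normal_equation// big_ord_recr/= -normal_equation//.
rewrite gramS mulmxDl !mulmxDr -!scalemxAr gram_gain// -!mulmxA.
rewrite !mulmx11 -/(leverage l l) scalerA -!addrA; congr (_ + _).
rewrite addrCA -!scalerDl; congr (_ *: _).
by rewrite /residual; field.
Qed.

(** After the update of the estimate the old residuals decrease by [c] times the
    leverages, to which they are orthogonal by [residual_design], and the new
    residual is [c]. The increment is thus [c ^ 2 * (h + 1)]. *)
Lemma rssS y l : (K + 1 <= l)%N -> rss y l.+1 = rss y l + recres y l ^+ 2.
Proof.
move=> Kl; rewrite /rss big_ord_recr/=.
set c := residual y l l / (1 + leverage l l).
have h0 : 1 + leverage l l != 0.
  by rewrite -sqr_resid_scale// expf_neq0// gt_eqF// resid_scale_gt0.
have rE i : residual y l.+1 i = residual y l i - c * leverage l i.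
  rewrite {1}/residual gammahatS// mulmxDr -scalemxAr mxE.
  by rewrite [X in y i.+1 - (_ + X)]mxE opprD addrA.
have cross : \sum_(i < l) residual y l i * leverage l i = 0.
  transitivity (((\sum_(i < l) residual y l i *: z i.+1)^T *m gain l) 0 0); last first.
    by rewrite residual_design// trmx0 mul0mx mxE.
  rewrite linear_sum mulmx_suml summxE; apply: eq_bigr => i _.
  by rewrite linearZ -scalemxAl [RHS]mxE.
rewrite (eq_bigr (fun i : 'I_l => residual y l i ^+ 2 +
  ((- 2 * c) * (residual y l i * leverage l i) + c ^+ 2 * leverage l i ^+ 2))).
  rewrite big_split big_split/= -!mulr_sumr cross sum_leverage// mulr0 add0r.
  rewrite -addrA; congr (_ + _); rewrite rE /recres [(_ / resid_scale l) ^+ 2]expr_div_n.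
  rewrite sqr_resid_scale// /c.
  by field.
by move=> i _; rewrite rE; ring.
Qed.

(** A square design of full rank fits the labels exactly. *)
Lemma rss0 y : rss y (K + 1) = 0.
Proof.
pose r : 'rV[R]_(K + 1) := \row_i residual y (K + 1) i.
have rZ : r *m Zmx x (K + 1) = 0.
  apply: trmx_inj; rewrite trmx0 -(residual_design y (leqnn _)) trmx_mul design_mulmx.
  by apply: eq_bigr => i _; apply/colP => j; rewrite mxE big_ord1 !mxE mulrC.
have free : row_free (Zmx x (K + 1)).
  by rewrite /row_free full_rank ?minnn// addn1.
have r0 : r = 0 by apply/eqP; rewrite -(mulmx_free_eq0 r free) rZ.
rewrite /rss big1// => i _; have /rowP/(_ i) := r0.
by rewrite !mxE => ->; rewrite expr0n.
Qed.

Lemma rss_recres y j : rss y (K + 1 + j) = \sum_(i < j) recres y (K + 1 + i) ^+ 2.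
Proof.
elim: j => [|j IH]; first by rewrite addn0 rss0 big_ord0.
by rewrite addnS rssS ?leq_addr// IH big_ord_recr.
Qed.

Lemma sigmahat_rss y l :
  sigmahat x (labels y l) = Num.sqrt ((l - K - 1)%:R^-1 * rss y l).
Proof.
have resE (i : 'I_l) :
    (labels y l - Zmx x l *m gammahat x (labels y l)) i 0 = residual y l i.
  rewrite mxE [X in X + _]mxE [X in _ + X]mxE [X in - X]mxE; congr (_ - _).
  by rewrite [RHS]mxE; apply: eq_bigr => k _; rewrite [Zmx _ _ _ _]mxE.
rewrite /sigmahat; congr (Num.sqrt (_ * _)); rewrite mxE; apply: eq_bigr => i _.
by rewrite [X in X * _]mxE resE expr2.
Qed.

End recursive_residuals.

(** * Prediction errors in the Gauss linear model *)

Lemma eq_independent_events (d : measure_display) (T : measurableType d)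
    (R : realType) (P : probability T R) (I : choiceType) (D : set I)
    (E' E : I -> set T) : (forall i, D i -> E i = E' i) ->
  independent_events P D E' -> independent_events P D E.
Proof.
move=> EE' [mE' iE']; split => [i Di|J JD]; first by rewrite EE'//; exact: mE'.
rewrite (eq_bigcapr (G := E')); last by move=> i Ji; apply: EE'; exact: JD.
rewrite iE'//; apply: eq_big_seq => i iJ; rewrite EE'//; exact: JD.
Qed.

Section gauss_model.
Context {R : realType} {K : nat} (x : nat -> 'cV[R]_K).
Hypothesis full_rank :
  forall l : nat, (1 <= l)%N -> \rank (Zmx x l) = minn l (K + 1).
Context (d : measure_display) (T : measurableType d) (P : probability T R).
Variables (alpha : R) (beta : 'cV[R]_K) (sigma : R) (xi : nat -> {RV P >-> R}).
Hypotheses (sigma0 : 0 < sigma) (noise : gauss_noise P sigma xi).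
Notation mR := (measurableTypeR R).
Notation N := (@normal_prob R 0 1).
Notation chi2 := (@chi2_prob R).

Let y w n := response x alpha beta xi n w.

Lemma noise_std_iid n : std_iid P setT n (fun i w => xi i.+1 w / sigma).
Proof.
have msig : measurable_fun setT (fun u : R => u / sigma) by exact: measurable_funM.
split => [i _|B mB]; first exact: (measurableT_comp msig (measurable_funPT (xi i.+1))).
have mB' i : measurable ((fun u : R => u / sigma) @^-1` B i).
  by rewrite -[X in measurable X]setTI; exact: msig.
have [lawE indep] := noise.
pose J : {fset nat} := [fset i in iota 1 n]%fset.
have inJ i : (i \in J) = (0 < i < n.+1)%N.
  by rewrite inE/= mem_iota add1n.
have [_ /(_ J)] := indep (fun k => (fun u : R => u / sigma) @^-1` B k.-1)
  (fun k => mB' k.-1).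
have JD : [set` J] `<=` [set k | (0 < k)%N] by move=> k /=; rewrite inJ => /andP[].
move=> /(_ JD) PJ; rewrite setTI (_ : P setT = 1%E); last exact: probability_setT.
rewrite mul1e.
transitivity (P (\bigcap_(i in [set` J])
    (xi i @^-1` ((fun u : R => u / sigma) @^-1` B i.-1)))).
  congr (P _); apply/seteqP; split => w H k /=.
    by rewrite inJ; case: k => // k kn; exact: (H k).
  by move=> kn; apply: (H k.+1); rewrite /= inJ.
rewrite PJ (perm_big (iota 1 n)); last first.
  apply: uniq_perm; [exact: fset_uniq|exact: iota_uniq|].
  by move=> i; rewrite inJ mem_iota add1n.
rewrite (_ : iota 1 n = index_iota 1 n.+1); last by rewrite /index_iota subn1.
rewrite big_add1 big_mkord; apply: eq_bigr => i _.
apply: (etrans (lawE i.+1 isT _ (mB' i))).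
rewrite (normal_prob_scale sigma0 (mB' i)).
by congr (N _); apply/funext => u /=; rewrite mulrAC divff ?mul1r// gt_eqF.
Qed.

(** The systematic part is linear in the regressors, hence annihilated by the
    coefficients of the recursive residuals. *)
Lemma responseE w n :
  y w n = ((zvec x n)^T *m col_mx (const_mx alpha) beta) 0 0 + xi n w.
Proof.
rewrite /y /response; congr (_ + _).
rewrite /zvec tr_col_mx mul_row_col [RHS]mxE dotC; congr (_ + _).
by rewrite mxE big_ord1 !mxE mul1r.
Qed.

Definition std_recres (j : nat) (w : T) : R :=
  recres x (y w) (K + 1 + j) / sigma.

Lemma std_recres_iid k : std_iid P setT k std_recres.
Proof.
pose n := (K + 1 + k)%N; pose A j := recres_coef x (K + 1 + j).
have oA : orthonormal_rows n k A.
  move=> j j' jk j'k; rewrite /A (recres_coef_orthonormal full_rank).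
  - by rewrite eqn_add2l.
  - exact: leq_addr.
  - exact: leq_addr.
  - by rewrite ltn_add2l.
  - by rewrite ltn_add2l.
have E j : (j < k)%N -> (fun w => \sum_(i < n) A j i * (xi i.+1 w / sigma)) = std_recres j.
  move=> jk; apply/funext => w.
  rewrite /std_recres (@recresE R K x full_rank (y w) (K + 1 + j) n) ?leq_addr ?ltn_add2l//.
  rewrite [in RHS](eq_bigr (fun i : 'I_n =>
     recres_coef x (K + 1 + j) i *
       ((zvec x i.+1)^T *m col_mx (const_mx alpha) beta) 0 0 +
     recres_coef x (K + 1 + j) i * xi i.+1 w)); last first.
    by move=> i _; rewrite responseE mulrDr.
  rewrite big_split/= (recres_coef_design full_rank) ?leq_addr ?ltn_add2l//.
  by rewrite add0r mulr_suml; apply: eq_bigr => i _; rewrite mulrA.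
have [mW iW] := std_iid_orthonormal measurableT (noise_std_iid n) oA.
split => [j jk|B mB]; first by rewrite -E//; exact: mW.
rewrite -iW//; congr (P (_ `&` _)); apply: eq_bigcapr => j jk.
by rewrite -E.
Qed.

Definition cone_event (j : nat) (C : set (mR * mR)) : set T :=
  [set w | C (std_recres j w, \sum_(i < j) std_recres i w ^+ 2)].

(** [cone_chain] starting from the empty sum of squares, whose law is the
    chi-squared law with [0] degrees of freedom. *)
Lemma cone_event_prod k (C : nat -> set (mR * mR)) :
  (forall i, measurable (C i)) -> (forall i, cone dilation (C i)) ->
  P (\bigcap_(i < k) cone_event i (C i)) = (\prod_(i < k) (N \x chi2 i) (C i))%E.
Proof.
move=> mC coneC; have [mW iW] := std_recres_iid k.
have := @cone_chain _ T R P k 0%N setT (fun=> 0) std_recres C measurableT.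
move=> /(_ (measurable_cst _) mW _ mC coneC).
rewrite setTI (_ : P setT = 1%E); last exact: probability_setT.
rewrite mul1e => <-; last first.
  move=> B A mB mA; have := iW A mA; rewrite !setTI.
  rewrite (_ : P setT = 1%E); last exact: probability_setT.
  rewrite !mul1e => PA; rewrite /chi2_prob/= diracE.
  case: (boolP (0 \in B)) => B0.
    rewrite mul1e -PA (_ : _ @^-1` B = setT) ?setTI//.
    by apply/seteqP; split => // w _; rewrite /= -in_setE.
  rewrite mul0e (_ : _ @^-1` B = set0) ?set0I ?measure0//.
  by apply/seteqP; split => // w /= H; move: B0; rewrite notin_setE; apply.
congr (P _); apply: eq_bigcapr => i _; apply/funext => w.
by rewrite /cone_event/= add0r.
Qed.

Lemma measurable_cone_event j C : measurable C -> measurable (cone_event j C).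
Proof.
move=> mC; have mW i : measurable_fun setT (std_recres i).
  by have [mW _] := std_recres_iid i.+1; exact: mW.
have mWS : measurable_fun setT
    (fun w => (std_recres j w : mR, \sum_(i < j) std_recres i w ^+ 2 : mR)).
  apply: measurable_fun_pair; first exact: mW.
  by apply: measurable_sum => i; apply: measurable_funX; exact: mW.
by rewrite -[X in measurable X]setTI; exact: mWS.
Qed.

Lemma cone_event_prob j C : measurable C -> cone dilation C ->
  P (cone_event j C) = (N \x chi2 j)%E C.
Proof.
move=> mC coneC; pose C' i := if i == j then C else setT.
have -> : cone_event j C = \bigcap_(i < j.+1) cone_event i (C' i).
  apply/seteqP; split => [w Cw i _|w Cw]; rewrite /C'.
    by case: eqP => // ->.
  by have := Cw j (ltnSn j); rewrite /C' eqxx.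
rewrite cone_event_prod; last 2 first.
- by move=> i; rewrite /C'; case: ifP => // _; exact: measurableT.
- by move=> i; rewrite /C'; case: ifP.
rewrite big_ord_recr/= /C' eqxx big1 ?mul1e// => i _.
by rewrite (ltn_eqF (ltn_ord i)); exact: probability_setT.
Qed.

(** For a finite set of indices, the remaining indices below a common bound are
    given the whole plane as their cone. *)
Lemma independent_cone_events (C : nat -> set (mR * mR)) :
  (forall n, measurable (C n)) -> (forall n, cone dilation (C n)) ->
  independent_events P [set n | (K + 3 <= n)%N]
    (fun n => cone_event (n - K - 2) (C n)).
Proof.
move=> mC coneC; split => [n _|J JD]; first exact: measurable_cone_event.
pose k := (\max_(n <- J) n).+1; pose f j := (j + K + 2)%N.
pose C' j := if f j \in J then C (f j) else setT.
have fK j : (f j - K - 2)%N = j by rewrite /f -subnDA -addnA addnK.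
have Jf n : n \in J -> f (n - K - 2)%N = n /\ (n - K - 2 < k)%N.
  move=> nJ; have := JD n nJ; rewrite /= => Kn; split.
    by rewrite /f -subnDA -addnA subnK// (leq_trans _ Kn)// leq_add2l.
  rewrite ltnS -subnDA (leq_trans (leq_subr _ _))//.
  exact: (@leq_bigmax_seq _ _ _ id).
have -> : \bigcap_(n in [set` J]) cone_event (n - K - 2) (C n) =
    \bigcap_(j < k) cone_event j (C' j).
  apply/seteqP; split => w Cw.
    move=> j _; rewrite /C'; case: ifP => // fJ.
    by have := Cw _ fJ; rewrite fK.
  move=> n /= nJ; have [fn nk] := Jf n nJ.
  by have := Cw _ nk; rewrite /C' fn nJ.
rewrite cone_event_prod; last 2 first.
- by move=> j; rewrite /C'; case: ifP => // _; exact: measurableT.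
- by move=> j; rewrite /C'; case: ifP.
pose g n := (N \x chi2 (n - K - 2))%E (C n).
transitivity (\prod_(n <- J) g n)%E; last first.
  by apply: eq_bigr => n _; rewrite cone_event_prob.
transitivity (\prod_(n <- [seq f j | j <- index_iota 0 k] | n \in J) g n)%E.
  rewrite big_map [RHS]big_mkcond big_mkord; apply: eq_bigr => j _.
  rewrite /C' /g; case: ifP => _; first by rewrite fK.
  exact: probability_setT.
rewrite -big_filter; apply: perm_big; apply: uniq_perm.
- rewrite filter_uniq// map_inj_uniq ?iota_uniq// => i j.
  by move=> /(congr1 (fun n => n - K - 2)%N); rewrite !fK.
- exact: fset_uniq.
move=> n; rewrite mem_filter; apply/andP/idP => [[]//|nJ]; split => //.
have [fn nk] := Jf n nJ; apply/mapP; exists (n - K - 2)%N => //.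
by rewrite mem_index_iota.
Qed.

(** The observation number [K + 3 + j] is predicted from [K + 2 + j] others; its
    recursive residual is the one of index [j + 1], and the estimated variance
    has [j + 1] degrees of freedom. *)
Lemma missE eps j : 0 < eps < 1 ->
  [set w | miss (classical_predictor x) eps (y w) (K + 3 + j)] =
  cone_event j.+1 (t_event j (t_upper j.+1 (eps / 2))).
Proof.
move=> eps01; set t := t_upper _ _; pose l := (K + 1 + j.+1)%N.
have -> : (K + 3 + j = l.+1)%N by rewrite /l; lia.
have Kl : (K + 1 <= l)%N by exact: leq_addr.
apply/funext => w; apply/propext.
rewrite /miss /classical_predictor /= [(l.+1 < _)%N]ltnNge.
have -> : (K + 3 <= l.+1)%N by rewrite /l; lia.
have -> : (l.+1 - K - 2 = j.+1)%N by rewrite /l; lia.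
rewrite -/t sigmahat_rss //= (_ : (l - K - 1 = j.+1)%N); last by rewrite /l; lia.
have s0 : 0 < resid_scale x l by exact: resid_scale_gt0.
rewrite (_ : 1 + _ = 1 + leverage x l l); last by rewrite /leverage /gain mulmxA.
rewrite -/(resid_scale x l).
rewrite (_ : y w l.+1 - _ = residual x (y w) l l); last by rewrite /residual /yhat dotC.
set r := residual _ _ _ _; set S := Num.sqrt _.
rewrite /cone_event /t_event/=.
rewrite (_ : \sum_(i < j.+1) _ = sigma ^- 2 * rss x (y w) l); last first.
  rewrite rss_recres// mulr_sumr; apply: eq_bigr => i _.
  by rewrite /std_recres expr_div_n mulrC.
rewrite (_ : sigma ^- 2 * _ / _ = sigma ^- 2 * (j.+1%:R^-1 * rss x (y w) l)); last first.
  by rewrite -mulrA; congr (_ * _); rewrite mulrC.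
rewrite sqrtrM ?invr_ge0 ?sqr_ge0// -/S.
rewrite sqrtrV ?sqr_ge0// sqrtr_sqr (gtr0_norm sigma0).
rewrite /std_recres -/l /recres -/r !normf_div (gtr0_norm sigma0) (gtr0_norm s0).
rewrite mulrCA [_ / sigma]mulrC ler_pM2l ?invr_gt0// ler_pdivlMr// mulrAC.
by rewrite leNgt; split => /negP.
Qed.

Lemma prob_miss eps n : (K + 3 <= n)%N -> 0 < eps < 1 ->
  P [set w | miss (classical_predictor x) eps (y w) n] = eps%:E.
Proof.
move=> /subnKC <- eps01; rewrite missE// cone_event_prob.
- exact: normal_chi2_t_event.
- exact: measurable_t_event.
- exact: cone_t_event.
Qed.

Definition miss_cone eps n : set (mR * mR) :=
  t_event (n - K - 3) (t_upper (n - K - 3).+1 (eps / 2)).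

Lemma miss_cone_event eps n : (K + 3 <= n)%N -> 0 < eps < 1 ->
  [set w | miss (classical_predictor x) eps (y w) n] =
  cone_event (n - K - 2) (miss_cone eps n).
Proof.
move=> Kn eps01; rewrite /miss_cone.
have nE : (K + 3 + (n - K - 3) = n)%N by lia.
have := missE (n - K - 3) eps01; rewrite nE => ->.
by have -> : (n - K - 2 = (n - K - 3).+1)%N by lia.
Qed.

Lemma independent_miss eps : 0 < eps < 1 -> independent_events P
  [set n | (K + 3 <= n)%N]
  (fun n => [set w | miss (classical_predictor x) eps (y w) n]).
Proof.
move=> eps01.
apply: (@eq_independent_events _ _ _ _ _ _
  (fun n => cone_event (n - K - 2) (miss_cone eps n))).
  by move=> n Kn; exact: (miss_cone_event Kn eps01).
apply: independent_cone_events => n.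
- exact: measurable_t_event.
- exact: cone_t_event.
Qed.

(** The preimage of [B n] under [err] is a union of the miss event, if
    [1 \in B n], and of its complement, if [0 \in B n]; complements and unions
    of cones are cones. *)
Lemma independent_err eps : 0 < eps < 1 -> independent_variables P
  [set n | (K + 3 <= n)%N]
  (fun n w => err (classical_predictor x) eps (y w) n).
Proof.
move=> eps01 B mB.
pose C n : set (mR * mR) := (if 1 \in B n then miss_cone eps n else set0) `|`
  (if 0 \in B n then ~` miss_cone eps n else set0).
apply: (@eq_independent_events _ _ _ _ _ _
  (fun n => cone_event (n - K - 2) (C n))).
  move=> n Kn; apply/funext => w; apply/propext.
  have mE : miss (classical_predictor x) eps (y w) n = miss_cone eps n
      (std_recres (n - K - 2) w, \sum_(i < n - K - 2) std_recres i w ^+ 2).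
    exact: (congr1 (fun A => A w) (miss_cone_event Kn eps01)).
  rewrite /cone_event /C /= /err.
  case: asboolP => m; have m' := m; rewrite mE in m'; split.
  - by move=> B1; left; rewrite ifT ?inE.
  - by case; case: ifP => // /set_mem.
  - by move=> B0; right; rewrite ifT ?inE.
  - by case; case: ifP => // /set_mem.
have mC n : measurable (miss_cone eps n) by exact: measurable_t_event.
apply: independent_cone_events => n.
  apply: measurableU; case: ifP => _; try exact: measurable0; first exact: mC.
  exact: measurableC.
move=> a p a0; have H : miss_cone eps n (dilation a p) <-> miss_cone eps n p.
  by apply: cone_t_event a0.
by rewrite /C; do 2 case: ifP => _; rewrite /setU/=; tauto.
Qed.

End gauss_model.

Theorem corollary2 (R : realType) (K : nat) (x : nat -> 'cV[R]_K)
    (full_rank : forall l : nat, (1 <= l)%N -> \rank (Zmx x l) = minn l (K + 1)) :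
  (forall (d : measure_display) (T : measurableType d) (P : probability T R)
     (alpha : R) (beta : 'cV[R]_K) (sigma : R) (xi : nat -> {RV P >-> R}),
     0 < sigma -> gauss_noise P sigma xi ->
     forall eps : R, 0 < eps < 1 ->
     independent_events P [set n : nat | (K + 3 <= n)%N]
       (fun n => [set w | miss (classical_predictor x) eps
                           (fun k => response x alpha beta xi k w) n])) /\
  strongly_valid x (K + 3) (classical_predictor x).
Proof.
split=> [d T P alpha beta sigma xi sigma0 noise eps eps01|].
  exact: (independent_miss full_rank alpha beta sigma0 noise eps01).
move=> d T P alpha beta sigma xi sigma0 noise /=; split => [n eps Kn eps01|eps eps01].
  rewrite -(prob_miss full_rank alpha beta sigma0 noise Kn eps01); congr (P _).
  apply/funext => w; apply/propext; rewrite /= /err.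
  by case: asboolP => m; split => // /esym/eqP; rewrite oner_eq0.
exact: (independent_err full_rank alpha beta sigma0 noise eps01).
Qed.
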